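(* Let $n\ge2$ and let $X_i=(W_i,R_i)$, $i=1,\dots,n$, be mutually independent random pairs with values in $(0,\infty)\times[0,1]$ (within each pair, $W_i$ and $R_i$ may be dependent). Let $S=(X_1,\dots,X_n)$ and \[ f^{\mathrm{wa}}(S)=\frac{\sum_{i=1}^nW_iR_i}{\sum_{j=1}^nW_j}. \] For each $k$ let $W_k'$ have the same distribution as $W_k$ and be independent of $(X_1,\dots,X_n)$, and set \[ \tilde W_k=\frac{W_k}{\sum_{j=1}^nW_j},\qquad \tilde U_k=\frac{W_k'}{W_k'+\sum_{j\ne k}W_j},\qquad V^{\mathrm{wa}}=\sum_{k=1}^n\mathbb{E}\big[\tilde W_k^2+\tilde U_k^2\,\big|\,W_1,\dots,W_k\big]. \] Then for every $y>0$ and $x\ge2$, with probability at least $1-e^{-x}$, \[ \big|f^{\mathrm{wa}}(S)-\mathbb{E}[f^{\mathrm{wa}}(S)]\big|\le\sqrt{2\,(2V^{\mathrm{wa}}+y)\Big(1+\ln\sqrt{1+2V^{\mathrm{wa}}/y}\Big)x}. \] *)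

(* Defs.v *)
From HB Require Import structures.
From mathcomp Require Import all_boot all_order all_algebra.
From mathcomp Require Import all_classical all_reals all_analysis.
Set Implicit Arguments. Unset Strict Implicit. Unset Printing Implicit Defensive.
Import Order.TTheory GRing.Theory Num.Theory.
Local Open Scope classical_set_scope.
Local Open Scope ring_scope.

Section defs.
Context {d : measure_display} {T : measurableType d} {R : realType}.

Definition sigma_of {dU} {U : measurableType dU} (X : T -> U) : set (set T) :=
  preimage_set_system setT X measurable.

Definition sigma_fam {I : Type} {dU} {U : measurableType dU}
    (J : set I) (X : I -> T -> U) : set (set T) :=
  <<s \bigcup_(i in J) sigma_of (X i) >>.

Definition mutually_independent (P : probability T R) {I : finType}
    (F : I -> set (set T)) : Prop :=
  forall (J : {set I}) (A : I -> set T),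
    (forall i, i \in J -> F i (A i)) ->
    P (\bigcap_(i in [set i | i \in J]) A i) = (\prod_(i in J) P (A i))%E.

Definition independent2 (P : probability T R) (F G : set (set T)) : Prop :=
  forall A B, F A -> G B -> P (A `&` B) = (P A * P B)%E.

Definition is_cond_exp (P : probability T R) (G : set (set T)) (Z Y : T -> R)
    : Prop :=
  [/\ forall B : set R, measurable B -> G (Y @^-1` B),
      P.-integrable setT (fun t => (Y t)%:E) &
      forall A, G A -> (\int[P]_(t in A) (Y t)%:E = \int[P]_(t in A) (Z t)%:E)%E].

End defs.

Definition pair_rv {T R : Type} (W Rr : T -> R) : T -> R * R :=
  fun t => (W t, Rr t).

Definition f_wa {T : Type} {R : realType} (n : nat) (W Rr : 'I_n -> T -> R)
  (t : T) : R := (\sum_(i < n) W i t * Rr i t) / (\sum_(j < n) W j t).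

Definition Wtilde {T : Type} {R : realType} (n : nat) (W : 'I_n -> T -> R)
  (k : 'I_n) (t : T) : R := W k t / (\sum_(j < n) W j t).

Definition Utilde {T : Type} {R : realType} (n : nat) (W W' : 'I_n -> T -> R)
  (k : 'I_n) (t : T) : R :=
  W' k t / (W' k t + \sum_(j < n | j != k) W j t).

(* Main.v *)
(** Let [g_k = E[f | X_1, ..., X_k]]. Given the first [k - 1] pairs, the increment
    [g_k - g_(k-1)] is the average over an independent copy [X_k'] of [X_k], and
    over the later pairs, of the change [f - f'] caused by replacing [X_k] with
    [X_k']; that change satisfies [(f - f')^2 <= 2 (W~_k^2 + U~_k^2)]. Jensen's
    inequality and the symmetry between [X_k] and [X_k'] reduce
    [E exp (l (g_k - g_(k-1)) - l^2 V_k) <= 1] to [cosh z <= exp (z^2 / 2)], where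
    [V_k] averages [W~_k^2 + U~_k^2]. Multiplying over [k] gives
    [E exp (l (f - E f) - l^2 V) <= 1] for every [l]; integrating [l] against a
    centred Gaussian of variance [1 / y] and applying Markov's inequality
    yields the bound.

    Conditional expectations given independent blocks of coordinates are
    realised as partial integrals of functions that read each block off a
    separate sample point. *)
Require Import Defs.
From HB Require Import structures.
From mathcomp Require Import all_boot all_order all_algebra.
From mathcomp Require Import all_classical all_reals all_analysis.
From mathcomp Require Import measurable_realfun.
From mathcomp Require Import ring lra.
Set Implicit Arguments.
Unset Strict Implicit.
Import Order.TTheory GRing.Theory Num.Theory.
Local Open Scope classical_set_scope.
Local Open Scope ring_scope.

(** * Independence *)

Section independence.
Context d (T : measurableType d) (R : realType) (P : probability T R).

(** The sample space need not carry independent copies, and [V_k] is conditioned on [W_k] as well: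
    it is not known before step [k] and cannot be pulled out of the conditional expectation at that
    step. Hence coordinate [k] is read off its own point [s], and Jensen is applied for each fixed
    [s], with the increment and its variance term in one exponent; only then is [s] integrated and
    exchanged with the copy. With z = l (f - f'), the inequality used is exp (z - z^2/2) + exp (-z -
    z^2/2) <= 2, and z^2/2 <= l^2 (W~_k^2 + U~_k^2) accounts for l^2 V rather than l^2 V / 2, hence
    for 2V in the bound. The variables [W_k'] and the chosen versions of the conditional
    expectations enter only through a comparison: each version dominates an explicit partial
    integral off a null set, which suffices because the bound increases with V. *)

Lemma independent2_sym (F G : set (set T)) :
  independent2 P F G -> independent2 P G F.
Proof. by move=> FG A B GA FB; rewrite setIC muleC FG. Qed.

Lemma independent2S (F F' G G' : set (set T)) :
  F' `<=` F -> G' `<=` G -> independent2 P F G -> independent2 P F' G'.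
Proof. by move=> FF GG h A B /FF FA /GG GB; exact: h. Qed.

Lemma sigma_generated_measurable (C : set (set T)) :
  C `<=` measurable -> <<s C >> `<=` measurable.
Proof. by move=> mC; apply: smallest_sub => //; exact: sigma_algebra_measurable. Qed.

(** Pi-lambda argument: for fixed [B], the events satisfying the product formula with [B] form a
    Dynkin system containing the pi-system [C]. *)
Lemma independent2_generatedl (C G : set (set T)) :
  C `<=` measurable -> G `<=` measurable -> setI_closed C ->
  independent2 P C G -> independent2 P <<s C >> G.
Proof.
move=> mC mG CI CG A B sA GB.
have mB := mG _ GB.
have [q Eq] : exists q, P B = q%:E.
  by exists (fine (P B)); rewrite fineK// fin_num_measure.
suff H : <<s C >> `<=` [set A | measurable A /\ P (A `&` B) = (P A * P B)%E].
  by case: (H _ sA).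
rewrite -setI_closed_g_dynkin_g_sigma_algebra//.
apply: smallest_sub; last by move=> X CX; split; [exact: mC|exact: CG].
split.
- by split => //; rewrite setTI probability_setT mul1e.
- move=> X [mX PX]; split; first exact: measurableC.
  have -> : P (~` X `&` B) = (P B - P (X `&` B))%E.
    rewrite setIC -setDE measureD//; first by rewrite (setIC B).
    exact: le_lt_trans (probability_le1 P mB) (ltry _).
  rewrite PX probability_setC//.
  have [p ->] : exists p, P X = p%:E.
    by exists (fine (P X)); rewrite fineK// fin_num_measure.
  by rewrite Eq -EFinM -!EFinB -EFinM mulrBl mul1r.
- move=> F tF FP; have mF i : measurable (F i) by case: (FP i).
  split; first exact: bigcupT_measurable.
  rewrite setI_bigcupl measure_bigcup//; last 2 first.
    by move=> i _; exact: measurableI.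
    by apply: trivIset_setIr.
  rewrite measure_bigcup// [RHS]muleC Eq -nneseriesZl//.
  by apply: eq_eseriesr => i _; rewrite muleC -Eq; exact: (FP i).2.
Qed.

Lemma independent2_generated (C G : set (set T)) :
  C `<=` measurable -> G `<=` measurable -> setI_closed C -> setI_closed G ->
  independent2 P C G -> independent2 P <<s C >> <<s G >>.
Proof.
move=> mC mG CI GI CG; apply: independent2_generatedl => //.
  exact: sigma_generated_measurable.
by apply/independent2_sym/independent2_generatedl => //; exact: independent2_sym.
Qed.

Lemma sigma_of_setI dU (U : measurableType dU) (X : T -> U) :
  setI_closed (sigma_of X).
Proof.
move=> _ _ [A mA <-] [B mB <-]; exists (A `&` B); first exact: measurableI.
by rewrite !setTI preimage_setI.
Qed.

Lemma sigma_of_measurable dU (U : measurableType dU) (X : T -> U) :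
  measurable_fun setT X -> sigma_of X `<=` measurable.
Proof. by move=> mX _ [A mA <-]; exact: mX. Qed.

Section family.
Context (I : finType) dU (U : measurableType dU) (X : I -> T -> U).
Hypothesis mX : forall i, measurable_fun setT (X i).

Lemma sigma_fam_measurable (J : set I) : sigma_fam J X `<=` measurable.
Proof.
apply: sigma_generated_measurable => A [i _]; exact: sigma_of_measurable.
Qed.

(** The union of the generators over [J] is not closed under intersection; intersections of one
    event per index of [J] are, and they generate the same sigma-algebra. *)
Let cylinder (J : set I) : set (set T) :=
  [set \bigcap_(i in J) A i | A in [set A | forall i, sigma_of (X i) (A i)]].

Let cylinder_setI (J : set I) : setI_closed (cylinder J).
Proof.
move=> _ _ [A sA <-] [B sB <-]; exists (fun i => A i `&` B i).
  by move=> i; exact: sigma_of_setI.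
by rewrite bigcapI.
Qed.

Let cylinder_measurable (J : set I) : cylinder J `<=` measurable.
Proof.
move=> _ [A sA <-]; apply: fin_bigcap_measurable; first exact: finite_finset.
by move=> i _; exact: sigma_of_measurable (sA i).
Qed.

Let sigma_fam_cylinder (J : set I) : sigma_fam J X = <<s cylinder J >>.
Proof.
apply/seteqP; split.
  apply: smallest_sub; first exact: smallest_sigma_algebra.
  move=> A [i Ji sA]; apply: sub_gen_smallest.
  exists (fun j => if j == i then A else setT).
    move=> j; case: eqVneq => [->//|_].
    by exists setT => //; rewrite preimage_setT setTI.
  apply/seteqP; split => [t /(_ i Ji)|t At j _]; first by rewrite eqxx.
  by case: eqVneq.
apply: smallest_sub; first exact: smallest_sigma_algebra.
move=> _ [A sA <-].
have : @measurable _ (g_sigma_algebraType (\bigcup_(i in J) sigma_of (X i)))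
    (\bigcap_(i in J) A i).
  apply: fin_bigcap_measurable; first exact: finite_finset.
  by move=> i Ji; apply: sub_gen_smallest; exists i.
by [].
Qed.

(** On cylinders, the events chosen over [J] and over [K] merge into one family [D] because the
    blocks are disjoint, and mutual independence splits the product over their union. *)
Lemma mutually_independent_blocks (J K : set I) :
  mutually_independent P (fun i => sigma_of (X i)) -> [disjoint J & K]%classic ->
  independent2 P (sigma_fam J X) (sigma_fam K X).
Proof.
move=> indX JK; rewrite !sigma_fam_cylinder.
apply: independent2_generated => // _ _ [A sA <-] [B sB <-].
pose fJ : {set I} := [set i | `[< J i >]]%SET.
pose fK : {set I} := [set i | `[< K i >]]%SET.
pose D i := if i \in fJ then A i else B i.
have sD i : sigma_of (X i) (D i) by rewrite /D; case: ifP.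
have fJP i : reflect (J i) (i \in fJ) by rewrite finset.in_set; exact: asboolP.
have fKP i : reflect (K i) (i \in fK) by rewrite finset.in_set; exact: asboolP.
have inK i : i \in fK -> i \in fJ = false.
  move=> /fKP Ki; apply/negP => /fJP Ji.
  by move/disj_set2P : JK => /seteqP[/(_ i (conj Ji Ki))].
have EJ : \bigcap_(i in J) A i = \bigcap_(i in [set i | i \in fJ]) D i.
  apply/seteqP; split => t h i => [/= iJ|/fJP/= iJ].
    by rewrite /D iJ; apply: h; exact/fJP.
  by have := h i iJ; rewrite /D iJ.
have EK : \bigcap_(i in K) B i = \bigcap_(i in [set i | i \in fK]) D i.
  apply/seteqP; split => t h i => [/= iK|/fKP/= iK].
    by rewrite /D inK//; apply: h; exact/fKP.
  by have := h i iK; rewrite /D inK.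
rewrite EJ EK -bigcap_setU.
have -> : [set i | i \in fJ] `|` [set i | i \in fK] = [set i | i \in fJ :|: fK].
  by apply/seteqP; split => i /=; rewrite finset.in_setU => /orP.
rewrite !(indX _ D)//=.
rewrite (big_setID fJ)/=; congr (_ * _)%E; apply: eq_bigl => i.
  by rewrite finset.in_setI finset.in_setU; case: (i \in fJ) => //; rewrite andbF.
rewrite finset.in_setD finset.in_setU; have := inK i.
by case: (i \in fJ); case: (i \in fK) => // /(_ isT).
Qed.

End family.
End independence.

(** * Reading independent sigma-algebras off separate sample points *)

Section decoupling.
Context d (T : measurableType d) (R : realType) (P : probability T R).
Context (G1 G2 : set (set T)).
Hypotheses (mG1 : G1 `<=` measurable) (mG2 : G2 `<=` measurable).
Hypothesis indG : independent2 P <<s G1 >> <<s G2 >>.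
Local Notation T1 := (g_sigma_algebraType G1).
Local Notation T2 := (g_sigma_algebraType G2).

(** The diagonal map into [T1 * T2] pulls a rectangle back to the intersection of its sides, so by
    independence its law is the product of the marginal laws; Tonelli does the rest. No random
    variables are named: the sigma-algebras on [T1] and [T2] say which information each argument of
    [H] may use. *)
Lemma decouple (H : T1 * T2 -> R) :
  measurable_fun setT H -> (forall v, 0 <= H v) ->
  (\int[P]_t (H (t, t))%:E = \int[P]_t \int[P]_s (H (t, s))%:E)%E.
Proof.
move=> mH H0.
have mEH : measurable_fun setT (EFin \o H) by exact/measurable_EFinP.
have EH0 v : (0 <= (EFin \o H) v)%E by rewrite lee_fin.
have m1 : measurable_fun setT (id : T -> T1).
  by move=> _ B mB; rewrite setTI preimage_id; exact: sigma_generated_measurable mB.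
have m2 : measurable_fun setT (id : T -> T2).
  by move=> _ B mB; rewrite setTI preimage_id; exact: sigma_generated_measurable mB.
have m12 : measurable_fun setT ((fun t => (t, t)) : T -> (T1 * T2)%type).
  exact: (measurable_fun_pair m1 m2).
pose X1 : {mfun T >-> T1} :=
  HB.pack (id : T -> T1) (isMeasurableFun.Build _ _ _ _ _ m1).
pose X2 : {mfun T >-> T2} :=
  HB.pack (id : T -> T2) (isMeasurableFun.Build _ _ _ _ _ m2).
pose X12 : {mfun T >-> (T1 * T2)%type} :=
  HB.pack ((fun t => (t, t)) : T -> (T1 * T2)%type)
    (isMeasurableFun.Build _ _ _ _ _ m12).
have -> : (\int[P]_t (H (t, t))%:E =
    \int[distribution P X12]_v (EFin \o H) v)%E.
  by rewrite ge0_integral_distribution.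
have mprod (B : set (T1 * T2)) : measurable B ->
    (distribution P X1 \x distribution P X2)%E B = distribution P X12 B.
  apply: product_measure_unique => A C mA mC.
  exact: (indG mA mC).
rewrite (eq_measure_integral
    (distribution P X1 \x distribution P X2)%E); last first.
  by move=> B mB _; exact: (esym (mprod _ mB)).
rewrite fubini_tonelli1// ge0_integral_distribution; last 2 first.
- exact: measurable_fun_fubini_tonelli_F.
- by move=> t; exact: integral_ge0.
apply: eq_integral => t _ /=.
rewrite /fubini_F ge0_integral_distribution//.
by apply: measurableT_comp => //; exact: measurable_pair1.
Qed.
End decoupling.

(** * Integrals of bounded functions and exponentials *)

Section bounded_integrals.
Context d (T : measurableType d) (R : realType) (P : probability T R).
Implicit Types (f g : T -> R) (c : R).

Lemma le_norm_integrable f c : measurable_fun setT f ->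
  (forall t, `|f t| <= c) -> P.-integrable setT (EFin \o f).
Proof.
move=> mf fc; apply: measurable_bounded_integrable => //.
  exact: le_lt_trans (probability_le1 P measurableT) (ltry _).
exists c; split; first exact: num_real.
by move=> x cx t _ /=; exact: le_trans (fc t) (ltW cx).
Qed.

Lemma itv_integrable f c : measurable_fun setT f ->
  (forall t, 0 <= f t <= c) -> P.-integrable setT (EFin \o f).
Proof.
move=> mf fc; apply: (@le_norm_integrable _ c) => // t.
by have /andP[f0 fle] := fc t; rewrite ger0_norm.
Qed.

Lemma EFin_Rintegral f : P.-integrable setT (EFin \o f) ->
  (\int[P]_t f t)%:E = (\int[P]_t (f t)%:E)%E.
Proof. by move=> If; rewrite /Rintegral fineK// integrable_fin_num. Qed.

Lemma Rintegral_probability_cst c : \int[P]_t c = c.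
Proof.
transitivity (c * fine (P setT)); first exact: Rintegral_cst.
by rewrite probability_setT mulr1.
Qed.

Lemma Rintegral_itv f c : measurable_fun setT f ->
  (forall t, 0 <= f t <= c) -> 0 <= \int[P]_t f t <= c.
Proof.
move=> mf fc; rewrite Rintegral_ge0/=; last by move=> t _; have /andP[] := fc t.
have -> : c = \int[P]_t (cst c) t.
  by rewrite Rintegral_probability_cst.
apply: le_Rintegral => //; first exact: itv_integrable fc.
  exact: finite_measure_integrable_cst.
by move=> t _; have /andP[] := fc t.
Qed.

(** Average the tangent inequality [expR m * (1 + (z - m)) <= expR z] at the mean [m]. The
    exponential is not assumed integrable, so the right side is an extended real and its infinite
    value is split off. *)
Lemma jensen_expR f : P.-integrable setT (EFin \o f) -> measurable_fun setT f ->
  ((expR (\int[P]_t f t))%:E <= \int[P]_t (expR (f t))%:E)%E.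
Proof.
move=> If mf; set m := \int[P]_t f t.
have Im : P.-integrable setT (EFin \o (fun=> m)).
  exact: finite_measure_integrable_cst.
have mexp : measurable_fun setT (fun t => (expR (f t))%:E).
  by apply/measurable_EFinP; exact: measurableT_comp.
have [->|] := eqVneq (\int[P]_t (expR (f t))%:E)%E +oo%E; first by rewrite leey.
rewrite -ltey => Iexp.
have Ie : P.-integrable setT (EFin \o (expR \o f)).
  apply/integrableP; split => //.
  rewrite (eq_integral (fun t => (expR (f t))%:E))// => t _.
  by rewrite /= ger0_norm ?expR_ge0.
rewrite -EFin_Rintegral// lee_fin.
have IB : P.-integrable setT (EFin \o (fun t => f t - m)).
  by have := integrableB measurableT If Im; apply: eq_integrable.
have I1 : P.-integrable setT (EFin \o (fun=> 1 : R)).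
  exact: finite_measure_integrable_cst.
have ID : P.-integrable setT (EFin \o (fun t => 1 + (f t - m))).
  by have := integrableD measurableT I1 IB; apply: eq_integrable.
have -> : expR m = \int[P]_t (expR m * (1 + (f t - m))).
  rewrite RintegralZl// RintegralD// RintegralB// -/m !Rintegral_probability_cst.
  by rewrite subrr addr0 mulr1.
apply: le_Rintegral => //.
  by have := integrableZl measurableT (expR m) ID; apply: eq_integrable.
move=> t _; rewrite -[f t in leRHS](subrKC m) expRD ler_pM2l ?expR_gt0//.
exact: expR_ge1Dx.
Qed.

End bounded_integrals.

(** * The inequality cosh z <= exp (z^2 / 2) *)

Section cosh_bound.
Import numFieldNormedType.Exports.
Context (R : realType).
Implicit Types x : R.

Let ndecr_from0 (f f' : R -> R) x : (forall y : R, is_derive y (1 : R) f (f' y)) ->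
  (forall y, 0 < y -> 0 <= f' y) -> 0 <= x -> f 0 <= f x.
Proof.
move=> df f'0 x0.
apply: (@ger0_derive1_ndecr _ f 0 x) => //.
- move=> y; rewrite in_itv/= => /andP[y0 _].
  by rewrite derive1E (@derive_val _ _ _ _ _ _ _ (df y)) f'0.
- by apply: derivable_within_continuous => y _; exact: (@ex_derive _ _ _ _ _ _ _ (df y)).
Qed.

(** A rearrangement of tanh x <= x. The difference of the two sides has derivative 1 - (1 - 2x) exp
    (2x), nonnegative because 1 - 2x <= exp (-2x). *)
Let slope_le0 x : 0 <= x -> (1 - x) * expR (2 * x) <= 1 + x.
Proof.
move=> x0.
pose f (x : R) := 1 + x - (1 - x) * expR (2 * x).
pose f' (x : R) := 1 - (- 1 * expR (2 * x) + (1 - x) * (2 * expR (2 * x))).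
suff : f 0 <= f x by rewrite /f mulr0 expR0 mulr1 subr0 addr0 subrr subr_ge0.
apply: (@ndecr_from0 f f') => // y.
  rewrite /f; apply: is_derive_eq; rewrite /f' /GRing.scale /=; ring.
move=> y0; rewrite /f'.
have : (1 - 2 * y) * expR (2 * y) <= 1.
  rewrite -ler_pdivlMr ?expR_gt0// mul1r -expRN.
  exact: expR_ge1Dx.
lra.
Qed.

(** This is cosh x <= exp (x^2 / 2) with the Gaussian factor moved to the left. The derivative of
    [f] is exp (-x - x^2/2) times (1 + x) - (1 - x) exp (2x). *)
Let expR_sym_ge0 x : 0 <= x ->
  expR (x - x ^+ 2 / 2) + expR (- x - x ^+ 2 / 2) <= 2.
Proof.
move=> x0.
pose f (x : R) := 2 - (expR (x - x ^+ 2 / 2) + expR (- x - x ^+ 2 / 2)).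
pose f' (x : R) := - ((1 - x) * expR (x - x ^+ 2 / 2) +
                     (- 1 - x) * expR (- x - x ^+ 2 / 2)).
suff : f 0 <= f x.
  by rewrite /f oppr0 expr0n/= mul0r subr0 expR0; lra.
apply: (@ndecr_from0 f f') => // y.
  by rewrite /f; apply: is_derive_eq; rewrite /f' /GRing.scale /=; field.
move=> y0; rewrite /f'.
have -> : y - y ^+ 2 / 2 = 2 * y + (- y - y ^+ 2 / 2) by ring.
rewrite expRD mulrA -mulrDl -mulNr mulr_ge0 ?expR_ge0//.
by have := slope_le0 (ltW y0); lra.
Qed.

Lemma expR_sym_le2 (l x : R) :
  expR (l * x - l ^+ 2 / 2 * x ^+ 2) +
  expR (l * - x - l ^+ 2 / 2 * (- x) ^+ 2) <= 2.
Proof.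
wlog lx0 : x / 0 <= l * x => [wlg|].
  have [|/ltW lx0] := leP 0 (l * x); first exact: wlg.
  by have /wlg : 0 <= l * - x; rewrite ?opprK 1?addrC// mulrN oppr_ge0.
have -> : l * x - l ^+ 2 / 2 * x ^+ 2 = l * x - (l * x) ^+ 2 / 2 by field.
have -> : l * - x - l ^+ 2 / 2 * (- x) ^+ 2 = - (l * x) - (l * x) ^+ 2 / 2.
  by field.
exact: expR_sym_ge0.
Qed.
End cosh_bound.

(** * One resampling step *)

Section swap.
Context d (T : measurableType d) (R : realType) (P : probability T R).

Lemma integral_probability_cst (c : \bar R) : (\int[P]_t c = c)%E.
Proof.
transitivity (c * P setT)%E; first exact: integral_cst.
by rewrite probability_setT mule1.
Qed.

(** By Tonelli, exchanging the arguments of [F] leaves the double integral unchanged, so twice its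
    value is at most 2. *)
Lemma integral_swap_le1 (F : T * T -> \bar R) : measurable_fun setT F ->
  (forall w, 0 <= F w)%E -> (forall s t, F (s, t) + F (t, s) <= 2%:E)%E ->
  (\int[P]_s \int[P]_t F (s, t) <= 1)%E.
Proof.
move=> mF F0 F2.
have mF1 s : measurable_fun setT (fun t => F (s, t)).
  exact: measurable_fun_pair2.
have mF2 s : measurable_fun setT (fun t => F (t, s)).
  exact: measurable_fun_pair1.
pose G1 s := (\int[P]_t F (s, t))%E; pose G2 s := (\int[P]_t F (t, s))%E.
have mG1 : measurable_fun setT G1 by exact: (measurable_fun_fubini_tonelli_F F).
have mG2 : measurable_fun setT G2 by exact: (measurable_fun_fubini_tonelli_G F).
have G10 s : (0 <= G1 s)%E by exact: integral_ge0.
have G20 s : (0 <= G2 s)%E by exact: integral_ge0.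
have E12 : (\int[P]_s G1 s = \int[P]_s G2 s)%E by exact: (fubini_tonelli F mF F0).
have G12 s : (G1 s + G2 s <= 2%:E)%E.
  rewrite /G1 /G2 -ge0_integralD// -[leRHS]integral_probability_cst.
  apply: ge0_le_integral => //.
  - by move=> u _; exact: adde_ge0.
  - exact: emeasurable_funD.
have : (\int[P]_s (G1 s + G2 s) <= 2%:E)%E.
  rewrite -[leRHS]integral_probability_cst; apply: ge0_le_integral => //.
  - by move=> u _; exact: adde_ge0.
  - exact: emeasurable_funD.
rewrite ge0_integralD// -E12 -/(\int[P]_s G1 s)%E.
have : (0 <= \int[P]_s G1 s)%E by exact: integral_ge0.
move: (\int[P]_s G1 s)%E => [a| |]//=; rewrite -EFinD !lee_fin; lra.
Qed.

End swap.

Section core.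
Context d (T : measurableType d) (R : realType) (P : probability T R).
Context (phi : T * T -> R) (l : R).
Hypotheses (mphi : measurable_fun setT phi) (phi01 : forall v, 0 <= phi v <= 1).
Local Notation Q := (P \x P)%E.

(** [v.1] is the copy of [s], and [v.2] carries the later coordinates, shared by both terms. In [e]
    each change is compensated by its own square; Jensen later averages these squares. *)
Let gap (s : T) (v : T * T) : R := phi (s, v.2) - phi (v.1, v.2).
Let e (x : R) : R := expR (l * x - l ^+ 2 / 2 * x ^+ 2).

Let me : measurable_fun setT e.
Proof.
apply: measurableT_comp => //; apply: measurable_funB; first exact: measurable_funM.
by apply: measurable_funM; [exact: measurable_cst|exact: measurable_funX].
Qed.

Let mgap : measurable_fun setT (fun w : T * T * T => gap w.1.1 (w.1.2, w.2)).
Proof.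
apply: measurable_funB; apply: (measurableT_comp mphi).
  apply: measurable_fun_pair; last exact: measurable_snd.
  exact: (measurableT_comp measurable_fst measurable_fst).
apply: measurable_fun_pair; last exact: measurable_snd.
exact: (measurableT_comp measurable_snd measurable_fst).
Qed.

Let mgap1 s : measurable_fun setT (gap s).
Proof.
apply: measurable_funB; apply: (measurableT_comp mphi).
  by apply: measurable_fun_pair => //; exact: measurable_snd.
by apply: measurable_fun_pair; [exact: measurable_fst|exact: measurable_snd].
Qed.

Let gap_le1 s v : `|gap s v| <= 1.
Proof.
have /andP[a0 a1] := phi01 (s, v.2); have /andP[b0 b1] := phi01 (v.1, v.2).
by rewrite ler_norml /gap; apply/andP; split; lra.
Qed.

Let mE : measurable_fun setT
  (fun w : T * T * T => (e (gap w.1.1 (w.1.2, w.2)))%:E).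
Proof. by apply/measurable_EFinP; exact: (measurableT_comp me mgap). Qed.

Let F (w : T * T) : \bar R := (\int[P]_u (e (gap w.1 (w.2, u)))%:E)%E.

Let mF : measurable_fun setT F.
Proof.
apply: (measurable_fun_fubini_tonelli_F
  (fun w : T * T * T => (e (gap w.1.1 (w.1.2, w.2)))%:E)) => // w.
by rewrite lee_fin expR_ge0.
Qed.

Let F0 w : (0 <= F w)%E.
Proof. by apply: integral_ge0 => u _; rewrite lee_fin expR_ge0. Qed.

Let F_swap s t : (F (s, t) + F (t, s) <= 2%:E)%E.
Proof.
have m1 (s' t' : T) : measurable_fun setT (fun u => (e (gap s' (t', u)))%:E).
  apply/measurable_EFinP; apply: (measurableT_comp me).
  apply: (measurableT_comp (mgap1 s')).
  exact: measurable_fun_pair.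
rewrite -ge0_integralD//; try by move=> u _; rewrite lee_fin expR_ge0.
rewrite -[leRHS](integral_probability_cst P); apply: ge0_le_integral => //=.
- by move=> u _; rewrite adde_ge0// lee_fin expR_ge0.
- exact: emeasurable_funD.
- move=> u _; rewrite -EFinD lee_fin.
  (* Both values use the same [u], so exchanging [s] and [t] only flips the sign of the gap. *)
  have -> : gap t (s, u) = - gap s (t, u) by rewrite /gap opprB.
  exact: expR_sym_le2.
Qed.

Let int_F_le1 : (\int[P]_s \int[P]_t F (s, t) <= 1)%E.
Proof. exact: integral_swap_le1. Qed.

(* By Jensen, [phi (s, _)] minus its mean and the variance proxy are both
   averages over an independent copy [v.1] of [s]; swapping [s] and [v.1] then
   symmetrises the exponent. *)
Lemma symmetrized_exp_moment_le1 (h : T -> R) : measurable_fun setT h ->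
  (forall s, \int[Q]_v (phi (s, v.2) - phi (v.1, v.2)) ^+ 2 <= 2 * h s) ->
  (\int[P]_s (expR (l * (\int[P]_u phi (s, u) - \int[Q]_v phi v)
                    - l ^+ 2 * h s))%:E <= 1)%E.
Proof.
move=> mh hh; apply: le_trans int_F_le1.
have mphis s : measurable_fun setT (fun u => phi (s, u)).
  exact: measurable_fun_pair2.
have mphis2 s : measurable_fun setT (fun v : T * T => phi (s, v.2)).
  exact: (measurableT_comp (mphis s) measurable_snd).
have IQ (f : T * T -> R) : measurable_fun setT f -> (forall v, `|f v| <= 1) ->
    Q.-integrable setT (EFin \o f).
  by move=> mf f1; apply: (@le_norm_integrable _ _ _ _ _ 1).
have nphi v : `|phi v| <= 1.
  by have /andP[p0 p1] := phi01 v; rewrite ger0_norm.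
have mint : measurable_fun setT (fun s => \int[P]_u phi (s, u)).
  apply: measurableT_comp => //.
  apply: (measurable_fun_fubini_tonelli_F (fun v => (phi v)%:E)).
    exact/measurable_EFinP.
  by move=> v; rewrite lee_fin; have /andP[] := phi01 v.
have mFs s : measurable_fun setT (fun t => F (s, t)).
  exact: measurable_fun_pair2.
apply: ge0_le_integral => //=.
- apply/measurable_EFinP; apply: measurableT_comp => //.
  apply: measurable_funB; last exact: measurable_funM.
  by apply: measurable_funM => //; exact: measurable_funB.
- exact: (measurable_fun_fubini_tonelli_F F).
move=> s _.
(* A dummy copy [v.1] is added so that all integrals are over the same product [Q]. *)
have Eint : \int[P]_u phi (s, u) = \int[Q]_v phi (s, v.2).
  rewrite /Rintegral; congr fine.
  rewrite (fubini_tonelli1 (fun v : T * T => (phi (s, v.2))%:E)); last 2 first.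
  - exact/measurable_EFinP.
  - by move=> v; rewrite lee_fin; have /andP[] := phi01 (s, v.2).
  by rewrite /fubini_F/= integral_probability_cst.
pose xi v := l * gap s v - l ^+ 2 / 2 * gap s v ^+ 2.
have I1 := IQ _ (mgap1 s) (gap_le1 s).
have I2 : Q.-integrable setT (EFin \o (fun v => gap s v ^+ 2)).
  apply: IQ; first exact: measurable_funX.
  by move=> v; rewrite normrX exprn_ile1.
have I1' : Q.-integrable setT (EFin \o (fun v => l * gap s v)).
  by have := integrableZl measurableT l I1; apply: eq_integrable.
have I2' : Q.-integrable setT (EFin \o (fun v => l ^+ 2 / 2 * gap s v ^+ 2)).
  by have := integrableZl measurableT (l ^+ 2 / 2) I2; apply: eq_integrable.
have Ixi : Q.-integrable setT (EFin \o xi).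
  by have := integrableB measurableT I1' I2'; apply: eq_integrable.
have mxi : measurable_fun setT xi.
  by apply/measurable_EFinP; exact: measurable_int Ixi.
have -> : (\int[P]_t F (s, t) = \int[Q]_v (expR (xi v))%:E)%E.
  rewrite fubini_tonelli1//.
  by apply/measurable_EFinP; exact: measurableT_comp.
apply: le_trans (jensen_expR Ixi mxi).
rewrite lee_fin ler_expR /xi RintegralB// !RintegralZl//.
have -> : \int[Q]_v gap s v = \int[P]_u phi (s, u) - \int[Q]_v phi v.
  rewrite /gap RintegralB//; last 2 first.
  - by apply: IQ => // v; exact: nphi.
  - apply: IQ => [|v]; last exact: nphi.
    by apply: (measurableT_comp mphi); apply: measurable_fun_pair;
      [exact: measurable_fst|exact: measurable_snd].
  rewrite Eint; congr (_ - _).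
  by congr (Rintegral _ _ _); apply/funext => -[].
(* The factor 2 in the hypothesis on [h] cancels the 1/2 in the exponent. *)
rewrite lerD2l lerN2 -mulrA ler_wpM2l ?sqr_ge0//.
by have := hh s; rewrite /gap; lra.
Qed.

End core.

(** * Weighted averages and spliced samples *)

Lemma measurable_pred d (Z : measurableType d) (f : Z -> bool) :
  measurable_fun setT f -> measurable [set z | f z].
Proof.
move=> mf; rewrite (_ : [set z | f z] = setT `&` f @^-1` [set true]).
  by apply: mf.
by rewrite setTI.
Qed.

(** Writing g^-1 as g (g^2)^-1 reduces inversion to a power of a nonnegative function; where [g]
    vanishes both sides are 0. *)
Lemma measurable_divr d (Z : measurableType d) (R : realType) (f g : Z -> R) :
  measurable_fun setT f -> measurable_fun setT g ->
  measurable_fun setT (fun z => f z / g z).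
Proof.
move=> mf mg.
rewrite (_ : (fun z => _) = (fun z => f z * g z * (g z ^+ 2) `^ (- 1))); last first.
  apply/funext => z; rewrite powR_inv1 ?sqr_ge0//.
  have [->|g0] := eqVneq (g z) 0; first by rewrite invr0 !mulr0 mul0r.
  by field.
apply: measurable_funM; first exact: measurable_funM.
exact: (measurableT_comp (measurable_powR (- 1)) (measurable_funX 2 mg)).
Qed.

Lemma measurable_Rintegral d d' (Z : measurableType d) (O : measurableType d')
    (R : realType) (Q : probability O R) (F : Z * O -> R) :
  measurable_fun setT F -> (forall w, 0 <= F w) ->
  measurable_fun setT (fun z => \int[Q]_o F (z, o)).
Proof.
move=> mF F0; apply: measurableT_comp => //.
apply: (measurable_fun_fubini_tonelli_F (fun w => (F w)%:E)).
  exact/measurable_EFinP.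
by move=> w; rewrite lee_fin.
Qed.

(** [A] and [B] are the contributions of the other items. In [half], with c = a / (u + b) in [0, 1],
    the change is u x / (u + b) - v y / (v + b) + (v - u) c / (v + b), at most u / (u + b) + v / (v
    + b). Exchanging the roles bounds the absolute value by [p + q], and (p + q)^2 <= 2 (p^2 + q^2)
    gives the constant 2. *)
Lemma weighted_average_resample (R : realType) (A B w r w' r' : R) :
  0 <= A <= B -> 0 < w -> 0 <= r <= 1 -> 0 < w' -> 0 <= r' <= 1 ->
  ((w * r + A) / (w + B) - (w' * r' + A) / (w' + B)) ^+ 2 <=
  2 * ((w / (w + B)) ^+ 2 + (w' / (w' + B)) ^+ 2).
Proof.
have half (a b u v x y : R) : 0 <= a <= b -> 0 < u -> 0 <= x <= 1 ->
    0 < v -> 0 <= y <= 1 ->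
    (u * x + a) / (u + b) - (v * y + a) / (v + b) <= u / (u + b) + v / (v + b).
  move=> /andP[a0 ab] u0 /andP[x0 x1] v0 /andP[y0 y1].
  have ub : 0 < u + b by lra.
  have vb : 0 < v + b by lra.
  have xu : u * x <= u by rewrite ler_piMr// ltW.
  have yv : 0 <= v * y by rewrite mulr_ge0// ltW.
  have -> : (u * x + a) / (u + b) - (v * y + a) / (v + b) =
      (u * x / (u + b) - v * y / (v + b)) +
      (v - u) * (a / (u + b)) / (v + b).
    by field; rewrite !gt_eqF.
  apply: lerD.
    have h1 : u * x / (u + b) <= u / (u + b) by rewrite ler_pM2r ?invr_gt0.
    have h2 : 0 <= v * y / (v + b) by rewrite divr_ge0// ltW.
    lra.
  rewrite ler_pM2r ?invr_gt0//.
  have c0 : 0 <= a / (u + b) by rewrite divr_ge0// ltW.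
  have c1 : a / (u + b) <= 1 by rewrite ler_pdivrMr// mul1r; lra.
  nra.
move=> AB w0 r01 w'0 r'01.
have h1 := half _ _ _ _ _ _ AB w0 r01 w'0 r'01.
have h2 := half _ _ _ _ _ _ AB w'0 r'01 w0 r01.
move: h1 h2.
set p := w / _; set q := w' / _; set x := _ / _; set y := _ / _ => h1 h2.
have h : `|x - y| <= p + q by rewrite ler_norml; apply/andP; split; lra.
have pq0 : 0 <= p + q by exact: le_trans (normr_ge0 _) h.
move: h; rewrite -ler_sqr ?nnegrE// real_normK ?num_real// => /le_trans; apply.
have := sqr_ge0 (p - q); lra.
Qed.

Section weighted_average.
Context (Z : Type) (R : realType) (n : nat) (W Rr : 'I_n -> Z -> R).
Hypotheses (W_gt0 : forall i z, 0 < W i z) (Rr01 : forall i z, 0 <= Rr i z <= 1).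

Let sumW_ge0 z : 0 <= \sum_(j < n) W j z.
Proof. by apply: sumr_ge0 => j _; exact: ltW. Qed.

Lemma f_wa_01 z : 0 <= f_wa W Rr z <= 1.
Proof.
have num0 : 0 <= \sum_(i < n) W i z * Rr i z.
  apply: sumr_ge0 => j _; rewrite mulr_ge0 ?(ltW (W_gt0 _ _))//.
  by have /andP[] := Rr01 j z.
rewrite /f_wa divr_ge0//=.
have [->|s0] := eqVneq (\sum_(j < n) W j z) 0; first by rewrite invr0 mulr0 ler01.
rewrite ler_pdivrMr ?lt0r ?s0 ?sumW_ge0// mul1r; apply: ler_sum => j _.
by rewrite ler_piMr ?(ltW (W_gt0 _ _))//; have /andP[] := Rr01 j z.
Qed.

Lemma Wtilde_01 k z : 0 <= Wtilde W k z <= 1.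
Proof.
have s0 : 0 < \sum_(j < n) W j z.
  by rewrite (bigD1 k)//= ltr_pwDl// sumr_ge0// => j _; exact: ltW.
have w0 := ltW (W_gt0 k z); have s0' := ltW s0.
rewrite /Wtilde divr_ge0//= ler_pdivrMr// mul1r.
by rewrite (bigD1 k)//= lerDl sumr_ge0// => j _; exact: ltW.
Qed.

End weighted_average.

Lemma measurable_f_wa d (Z : measurableType d) (R : realType) n
    (W Rr : 'I_n -> Z -> R) :
  (forall i, measurable_fun setT (W i)) -> (forall i, measurable_fun setT (Rr i)) ->
  measurable_fun setT (f_wa W Rr).
Proof.
move=> mW mR; apply: measurable_divr.
- by apply: measurable_sum => i; exact: measurable_funM.
- exact: measurable_sum.
Qed.

Lemma measurable_Wtilde d (Z : measurableType d) (R : realType) n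
    (W : 'I_n -> Z -> R) k :
  (forall i, measurable_fun setT (W i)) -> measurable_fun setT (Wtilde W k).
Proof. by move=> mW; apply: measurable_divr => //; exact: measurable_sum. Qed.

(* [splice k X] takes the coordinates before, at and after [k] from the three
   components of its argument. *)
Definition splice (A T : Type) n (k : 'I_n) (X : 'I_n -> T -> A) (j : 'I_n)
    (v : T * T * T) : A :=
  if (j < k)%N then X j v.1.1 else if j == k then X j v.1.2 else X j v.2.

Definition split_at (A T : Type) n (k : nat) (X : 'I_n -> T -> A) (j : 'I_n)
    (w : T * T) : A :=
  if (j < k)%N then X j w.1 else X j w.2.

Section splice.
Context (A T : Type) (n : nat) (X : 'I_n -> T -> A).

(** Merging the last two points of [splice k] cuts the sample at [k], merging the first two cuts it
    at [k.+1]: consecutive martingale terms come from one function of three points. *)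
Lemma splice_split (k : 'I_n) t u j :
  splice k X j (t, u, u) = split_at k X j (t, u).
Proof. by rewrite /splice /split_at/=; case: ifP => // _; case: ifP. Qed.

Lemma splice_splitS (k : 'I_n) t u j :
  splice k X j (t, t, u) = split_at k.+1 X j (t, u).
Proof.
rewrite /splice /split_at/= ltnS (leq_eqVlt j k).
by case: (ltnP j k) => _; rewrite ?orbT// orbF -val_eqE.
Qed.

Lemma split_atn t u j : split_at n X j (t, u) = X j t.
Proof. by rewrite /split_at ltn_ord. Qed.

Lemma splice_ind (Pr : A -> Prop) (k : 'I_n) j v :
  (forall i t, Pr (X i t)) -> Pr (splice k X j v).
Proof. by move=> h; rewrite /splice; case: ifP => // _; case: ifP. Qed.

Lemma split_ind (Pr : A -> Prop) k j w :
  (forall i t, Pr (X i t)) -> Pr (split_at k X j w).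
Proof. by move=> h; rewrite /split_at; case: ifP. Qed.

Lemma splice_neq (k : 'I_n) t s s' u j : j != k ->
  splice k X j (t, s, u) = splice k X j (t, s', u).
Proof. by rewrite /splice/= => /negbTE ->. Qed.

Lemma splice_at (k : 'I_n) t s u : splice k X k (t, s, u) = X k s.
Proof. by rewrite /splice/= ltnn eqxx. Qed.

End splice.

(** Measurability is asked of each point only for the coordinates read off it, so the points may
    range over [T] with a coarser sigma-algebra; this is how dependence on a block is expressed. *)
Lemma measurable_splice d dA (Z : measurableType d) (A : measurableType dA)
    (T : Type) n (k : 'I_n) (X : 'I_n -> T -> A) (a b c : Z -> T) j :
  (forall i : 'I_n, (i < k)%N -> measurable_fun setT (X i \o a)) ->
  measurable_fun setT (X k \o b) ->
  (forall i : 'I_n, (k < i)%N -> measurable_fun setT (X i \o c)) ->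
  measurable_fun setT (fun z => splice k X j (a z, b z, c z)).
Proof.
move=> ma mb mc; rewrite /splice/=.
have [jk|kj] := ltnP j k; first exact: ma.
have [->//|jk] := eqVneq j k.
by apply: mc; rewrite ltn_neqAle eq_sym kj andbT.
Qed.

Lemma measurable_split_at d dA (Z : measurableType d) (A : measurableType dA)
    (T : Type) n k (X : 'I_n -> T -> A) (a b : Z -> T) j :
  (forall i : 'I_n, (i < k)%N -> measurable_fun setT (X i \o a)) ->
  (forall i : 'I_n, (k <= i)%N -> measurable_fun setT (X i \o b)) ->
  measurable_fun setT (fun z => split_at k X j (a z, b z)).
Proof.
by move=> ma mb; rewrite /split_at/=; have [jk|kj] := ltnP j k; [exact: ma|exact: mb].
Qed.

(** * The exponential supermartingale *)

Lemma measurable_sigma_fam d (T : measurableType d) (I : Type) dU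
    (U : measurableType dU) (X : I -> T -> U) (J : set I) i : J i ->
  measurable_fun setT
    (X i : g_sigma_algebraType (\bigcup_(i in J) sigma_of (X i)) -> U).
Proof.
by move=> Ji _ B mB; apply: sub_gen_smallest; exists i => //; exists B.
Qed.

Lemma f_wa_ext (Z Z' : Type) (R : realType) n (W Rr : 'I_n -> Z -> R)
    (W' Rr' : 'I_n -> Z' -> R) z z' :
  (forall j, W j z = W' j z') -> (forall j, Rr j z = Rr' j z') ->
  f_wa W Rr z = f_wa W' Rr' z'.
Proof.
move=> WE RE; rewrite /f_wa; congr (_ / _); apply: eq_bigr => j _ //.
by rewrite WE RE.
Qed.

Section martingale.
Context d (T : measurableType d) (R : realType) (P : probability T R) (n : nat).
Context (W Rr : 'I_n -> T -> R).
Hypotheses (mW : forall i, measurable_fun setT (W i))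
  (mR : forall i, measurable_fun setT (Rr i)).
Hypotheses (W_gt0 : forall i t, 0 < W i t) (Rr01 : forall i t, 0 <= Rr i t <= 1).
Hypothesis indX :
  mutually_independent P (fun i => sigma_of (pair_rv (W i) (Rr i))).
Local Notation Q := (P \x P)%E.

Definition weight k (v : T * T * T) : R := Wtilde (splice k W) k v.

(** [v.1] supplies the replacement weight and [v.2] the weights after [k]. On the diagonal [s = t]
    this is an explicit version of the k-th summand of V^wa; [s] is kept apart so that coordinate
    [k] can be integrated with [t] frozen. *)
Definition variance_proxy k (t s : T) : R :=
  \int[Q]_v (weight k (t, s, v.2) ^+ 2 + weight k (t, v.1, v.2) ^+ 2).

Lemma splice_gt0 k j v : 0 < splice k W j v.
Proof.
by apply: (splice_ind (Pr := fun x => is_true (0 < x))) => *; exact: W_gt0.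
Qed.

Lemma weight_01 k v : 0 <= weight k v <= 1.
Proof. by apply: Wtilde_01 => i z; exact: splice_gt0. Qed.

Lemma measurable_weight dZ (Z : measurableType dZ) (a b c : Z -> T) (k : 'I_n) :
  (forall i : 'I_n, (i < k)%N -> measurable_fun setT (W i \o a)) ->
  measurable_fun setT (W k \o b) ->
  (forall i : 'I_n, (k < i)%N -> measurable_fun setT (W i \o c)) ->
  measurable_fun setT (fun z => weight k (a z, b z, c z)).
Proof.
move=> ma mb mc; apply: (@measurable_Wtilde _ _ _ _
    (fun j z => splice k W j (a z, b z, c z))) => i.
exact: (measurable_splice _ ma mb mc).
Qed.

Let weight2_02 k v w : 0 <= weight k v ^+ 2 + weight k w ^+ 2 <= 2.
Proof.
have /andP[v0 v1] := weight_01 k v; have /andP[w0 w1] := weight_01 k w.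
rewrite addr_ge0 ?sqr_ge0//=.
have : weight k v ^+ 2 <= 1 by rewrite expr_le1.
have : weight k w ^+ 2 <= 1 by rewrite expr_le1.
lra.
Qed.

Lemma measurable_weight2 dZ (Z : measurableType dZ) (a b : Z -> T)
    (k : 'I_n) :
  (forall i : 'I_n, (i < k)%N -> measurable_fun setT (W i \o a)) ->
  measurable_fun setT (W k \o b) ->
  measurable_fun setT (fun w : Z * (T * T) =>
    weight k (a w.1, b w.1, w.2.2) ^+ 2 + weight k (a w.1, w.2.1, w.2.2) ^+ 2).
Proof.
move=> ma mb.
have m2 : measurable_fun setT (fun w : Z * (T * T) => w.2.2).
  exact: (measurableT_comp measurable_snd measurable_snd).
have m1 : measurable_fun setT (fun w : Z * (T * T) => w.2.1).
  exact: (measurableT_comp measurable_fst measurable_snd).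
have mc i : measurable_fun setT (W i \o (fun w : Z * (T * T) => w.2.2)).
  exact: measurableT_comp.
have mac (i : 'I_n) : (i < k)%N ->
    measurable_fun setT (W i \o (fun w : Z * (T * T) => a w.1)).
  by move=> ik; exact: (measurableT_comp (ma i ik) measurable_fst).
apply: measurable_funD; apply: measurable_funX; apply: measurable_weight => //.
  exact: (measurableT_comp mb measurable_fst).
exact: measurableT_comp.
Qed.

Lemma measurable_variance_proxy dZ (Z : measurableType dZ) (a b : Z -> T)
    (k : 'I_n) :
  (forall i : 'I_n, (i < k)%N -> measurable_fun setT (W i \o a)) ->
  measurable_fun setT (W k \o b) ->
  measurable_fun setT (fun z => variance_proxy k (a z) (b z)).
Proof.
move=> ma mb; apply: (measurable_Rintegral _ (measurable_weight2 ma mb)) => w.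
by have /andP[] := weight2_02 k (a w.1, b w.1, w.2.2) (a w.1, w.2.1, w.2.2).
Qed.

Lemma weight2_integrable k t s : Q.-integrable setT
  (EFin \o (fun v => weight k (t, s, v.2) ^+ 2 + weight k (t, v.1, v.2) ^+ 2)).
Proof.
apply: (@itv_integrable _ _ _ _ _ 2) => [|v]; last exact: weight2_02.
have := @measurable_weight2 _ T (fun=> t) (fun=> s) k.
move=> /(_ (fun _ _ => measurable_cst _) (measurable_cst _)) m2.
exact: (measurable_fun_pair2 t m2).
Qed.

Lemma variance_proxy_02 k t s : 0 <= variance_proxy k t s <= 2.
Proof.
apply: Rintegral_itv => [|v]; last exact: weight2_02.
by apply/measurable_EFinP; exact: measurable_int (weight2_integrable k t s).
Qed.

Let phi k (v : T * T * T) : R := f_wa (splice k W) (splice k Rr) v.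
Let psi k (w : T * T) : R := f_wa (split_at k W) (split_at k Rr) w.

Let phi_01 k v : 0 <= phi k v <= 1.
Proof.
apply: f_wa_01 => [i z|i z]; first exact: splice_gt0.
by apply: (splice_ind (Pr := fun x => is_true (0 <= x <= 1))) => *; exact: Rr01.
Qed.

Let psi_01 k v : 0 <= psi k v <= 1.
Proof.
apply: f_wa_01 => [i z|i z].
  by apply: (split_ind (Pr := fun x => is_true (0 < x))) => *; exact: W_gt0.
by apply: (split_ind (Pr := fun x => is_true (0 <= x <= 1))) => *; exact: Rr01.
Qed.

Let psi_phi (k : 'I_n) t u : psi k (t, u) = phi k (t, u, u).
Proof. by apply: f_wa_ext => j; rewrite splice_split. Qed.

Let psiS_phi (k : 'I_n) t u : psi k.+1 (t, u) = phi k (t, t, u).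
Proof. by apply: f_wa_ext => j; rewrite splice_splitS. Qed.

(** Off [k] the two spliced samples agree, so their remaining sums are common constants [A] and [B]
    with 0 <= A <= B. *)
Let phi_gap k t s s' u : (phi k (t, s, u) - phi k (t, s', u)) ^+ 2 <=
  2 * (weight k (t, s, u) ^+ 2 + weight k (t, s', u) ^+ 2).
Proof.
have sumE (F : 'I_n -> R) : \sum_(j < n) F j = F k + \sum_(j < n | j != k) F j.
  exact: bigD1.
rewrite /phi /weight /f_wa /Wtilde !sumE !splice_at.
pose A := \sum_(j < n | j != k) splice k W j (t, s, u) * splice k Rr j (t, s, u).
pose B := \sum_(j < n | j != k) splice k W j (t, s, u).
have -> : \sum_(j < n | j != k)
    splice k W j (t, s', u) * splice k Rr j (t, s', u) = A.
  by apply: eq_bigr => j jk; rewrite (splice_neq _ _ s' s)// (splice_neq Rr _ s' s).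
have -> : \sum_(j < n | j != k) splice k W j (t, s', u) = B.
  by apply: eq_bigr => j jk; rewrite (splice_neq _ _ s' s).
apply: weighted_average_resample => //.
have R01 j v : 0 <= splice k Rr j v <= 1.
  by apply: (splice_ind (Pr := fun x => is_true (0 <= x <= 1))) => *; exact: Rr01.
apply/andP; split.
  apply: sumr_ge0 => j _; rewrite mulr_ge0 ?(ltW (splice_gt0 _ _ _))//.
  by have /andP[] := R01 j (t, s, u).
apply: ler_sum => j _; rewrite ler_piMr ?(ltW (splice_gt0 _ _ _))//.
by have /andP[] := R01 j (t, s, u).
Qed.

Let before (k : nat) : set 'I_n := [set j | (j < k)%N].
Let at_ (k : 'I_n) : set 'I_n := [set k].
Let after (k : 'I_n) : set 'I_n := [set j | (k < j)%N].
(** [TX J] is [T] under the sigma-algebra of the block [J], so dependence on that block alone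
    becomes ordinary measurability. *)
Local Notation GX J := (\bigcup_(i in J) sigma_of (pair_rv (W i) (Rr i))).
Local Notation TX J := (g_sigma_algebraType (GX J)).

Let mX i : measurable_fun setT (pair_rv (W i) (Rr i)).
Proof. exact: measurable_fun_pair. Qed.

Let mGX J : GX J `<=` measurable.
Proof. by move=> A [i _]; exact: sigma_of_measurable. Qed.

Let mWJ (J : set 'I_n) i : J i -> measurable_fun setT (W i : TX J -> R).
Proof.
move=> Ji; have := measurable_sigma_fam (X := fun i => pair_rv (W i) (Rr i)) Ji.
exact: (measurableT_comp measurable_fst).
Qed.

Let mRJ (J : set 'I_n) i : J i -> measurable_fun setT (Rr i : TX J -> R).
Proof.
move=> Ji; have := measurable_sigma_fam (X := fun i => pair_rv (W i) (Rr i)) Ji.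
exact: (measurableT_comp measurable_snd).
Qed.

Let measurable_phi dZ (Z : measurableType dZ) (a b c : Z -> T) (k : 'I_n) :
  (forall i : 'I_n, (i < k)%N ->
    measurable_fun setT (W i \o a) /\ measurable_fun setT (Rr i \o a)) ->
  measurable_fun setT (W k \o b) /\ measurable_fun setT (Rr k \o b) ->
  (forall i : 'I_n, (k < i)%N ->
    measurable_fun setT (W i \o c) /\ measurable_fun setT (Rr i \o c)) ->
  measurable_fun setT (fun z => phi k (a z, b z, c z)).
Proof.
move=> ma [mb mb'] mc; apply: (@measurable_f_wa _ _ _ _
    (fun j z => splice k W j (a z, b z, c z))
    (fun j z => splice k Rr j (a z, b z, c z))) => i.
- by apply: measurable_splice => // j jk; [have [] := ma _ jk|have [] := mc _ jk].
- by apply: measurable_splice => // j jk; [have [] := ma _ jk|have [] := mc _ jk].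
Qed.

Let measurable_psi dZ (Z : measurableType dZ) (a b : Z -> T) k :
  (forall i : 'I_n, (i < k)%N ->
    measurable_fun setT (W i \o a) /\ measurable_fun setT (Rr i \o a)) ->
  (forall i : 'I_n, (k <= i)%N ->
    measurable_fun setT (W i \o b) /\ measurable_fun setT (Rr i \o b)) ->
  measurable_fun setT (fun z => psi k (a z, b z)).
Proof.
move=> ma mb; apply: (@measurable_f_wa _ _ _ _
    (fun j z => split_at k W j (a z, b z))
    (fun j z => split_at k Rr j (a z, b z))) => i.
- by apply: measurable_split_at => // j jk; [have [] := ma _ jk|have [] := mb _ jk].
- by apply: measurable_split_at => // j jk; [have [] := ma _ jk|have [] := mb _ jk].
Qed.

Let g (k : nat) (t : T) : R := \int[P]_u psi k (t, u).
(** This is [g k.+1] with coordinate [k] read off a separate point [s]; indices start at 0, so [g k]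
    conditions on the [k] coordinates below [k]. *)
Let G (k : 'I_n) (t s : T) : R := \int[P]_u phi k (t, s, u).

Let g_before k : measurable_fun setT (g k : TX (before k) -> R).
Proof.
apply: (@measurable_Rintegral _ _ (TX (before k)) T _ P (psi k)); last first.
  by move=> w; have /andP[] := psi_01 k w.
rewrite (_ : psi k = fun w => psi k (w.1, w.2)); last by apply/funext => -[].
apply: (@measurable_psi _ (TX (before k) * T)%type fst snd) => i ik; split.
- by apply: (measurableT_comp _ measurable_fst); exact: mWJ.
- by apply: (measurableT_comp _ measurable_fst); exact: mRJ.
- exact: (measurableT_comp (mW i) measurable_snd).
- exact: (measurableT_comp (mR i) measurable_snd).
Qed.

Let G_before_at (k : 'I_n) : measurable_fun setT
  ((fun w => G k w.1 w.2) : (TX (before k) * TX (at_ k))%type -> R).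
Proof.
apply: (@measurable_Rintegral _ _ (TX (before k) * TX (at_ k))%type T _ P
  (fun w => phi k (w.1.1, w.1.2, w.2))); last first.
  by move=> w; have /andP[] := phi_01 k (w.1.1, w.1.2, w.2).
apply: (@measurable_phi _ (TX (before k) * TX (at_ k) * T)%type
  (fun w => w.1.1) (fun w => w.1.2) snd) => [i ik||i ik]; split.
- apply: (measurableT_comp (mWJ ik : measurable_fun setT (W i : TX (before k) -> R))).
  exact: (measurableT_comp measurable_fst measurable_fst).
- apply: (measurableT_comp (mRJ ik : measurable_fun setT (Rr i : TX (before k) -> R))).
  exact: (measurableT_comp measurable_fst measurable_fst).
- apply: (measurableT_comp (@mWJ (at_ k) k erefl)).
  exact: (measurableT_comp measurable_snd measurable_fst).
- apply: (measurableT_comp (@mRJ (at_ k) k erefl)).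
  exact: (measurableT_comp measurable_snd measurable_fst).
- exact: (measurableT_comp (mW i) measurable_snd).
- exact: (measurableT_comp (mR i) measurable_snd).
Qed.

Let measurable_phi_slice k t : measurable_fun setT (fun v => phi k (t, v.1, v.2)).
Proof.
apply: (@measurable_phi _ (T * T)%type (fun=> t) fst snd) => [i ik||i ik]; split.
- exact: measurable_cst.
- exact: measurable_cst.
- exact: (measurableT_comp (mW k) measurable_fst).
- exact: (measurableT_comp (mR k) measurable_fst).
- exact: (measurableT_comp (mW i) measurable_snd).
- exact: (measurableT_comp (mR i) measurable_snd).
Qed.

(** Coordinate [k] and the later ones are independent blocks, so they may be read off two points;
    this gives the mean the form that the symmetrisation step expects. *)
Let g_phi (k : 'I_n) t : g k t = \int[Q]_v phi k (t, v.1, v.2).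
Proof.
rewrite /g /Rintegral; congr fine.
under eq_integral do rewrite psi_phi.
have ind : independent2 P <<s GX (at_ k) >> <<s GX (after k) >>.
  apply: (mutually_independent_blocks mX) => //.
  by apply/disj_set2P/seteqP; split => // i [-> /=]; rewrite /after/= ltnn.
rewrite (@decouple _ _ _ P (GX (at_ k)) (GX (after k)) (@mGX _) (@mGX _) ind
  (fun v => phi k (t, v.1, v.2))); last 2 first.
- apply: (@measurable_phi _ (TX (at_ k) * TX (after k))%type (fun=> t) fst snd)
    => [i ik||i ik]; split.
  + exact: measurable_cst.
  + exact: measurable_cst.
  + exact: (measurableT_comp (@mWJ (at_ k) k erefl) measurable_fst).
  + exact: (measurableT_comp (@mRJ (at_ k) k erefl) measurable_fst).
  + exact: (measurableT_comp (mWJ ik : measurable_fun setT (W i : TX (after k) -> R)) measurable_snd).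
  + exact: (measurableT_comp (mRJ ik : measurable_fun setT (Rr i : TX (after k) -> R)) measurable_snd).
- by move=> v; have /andP[] := phi_01 k (t, v.1, v.2).
rewrite (fubini_tonelli1 (fun v => (phi k (t, v.1, v.2))%:E))//.
- exact/measurable_EFinP.
- by move=> v; rewrite lee_fin; have /andP[] := phi_01 k (t, v.1, v.2).
Qed.

Section exponential.
Context (l : R).
Local Notation Ef := (\int[P]_t f_wa W Rr t).

Let M (k : nat) (t : T) : R := expR (l * (g k t - Ef)
  - l ^+ 2 * \sum_(j < n | (j < k)%N) variance_proxy j t t).

Let D (k : 'I_n) (t s : T) : R :=
  expR (l * (G k t s - g k t) - l ^+ 2 * variance_proxy k t s).

Let MS (k : 'I_n) t : M k.+1 t = M k t * D k t t.
Proof.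
rewrite /M /D -expRD; congr expR.
have -> : g k.+1 t = G k t t by apply: eq_Rintegral => u _; exact: psiS_phi.
rewrite (bigD1 k)//=.
rewrite (eq_bigl (fun j : 'I_n => (j < k)%N)); last first.
  by move=> j /=; rewrite ltnS (ltn_neqAle j k) andbC.
ring.
Qed.

(** For frozen [t], the symmetrised bound applies to a slice of [phi]; its hypothesis is [phi_gap]
    integrated over the copy and the later coordinates. *)
Let D_le1 k t : (\int[P]_s (D k t s)%:E <= 1)%E.
Proof.
rewrite /D g_phi.
apply: (@symmetrized_exp_moment_le1 _ _ _ _ (fun v => phi k (t, v.1, v.2))) => //.
- apply: (@measurable_variance_proxy _ T (fun=> t) idfun) => [i _|].
    exact: measurable_cst.
  exact: mW.
- move=> s /=; rewrite /variance_proxy -RintegralZl//; last exact: weight2_integrable.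
  apply: le_Rintegral => //=.
  + apply: (@itv_integrable _ _ _ _ _ 1) => [|v].
      apply: measurable_funX; apply: measurable_funB => //.
      apply: (measurableT_comp (measurable_phi_slice k t) (g := fun v : T * T => (s, v.2))).
      by apply: measurable_fun_pair => //; exact: measurable_snd.
    have /andP[x0 x1] := phi_01 k (t, s, v.2).
    have /andP[y0 y1] := phi_01 k (t, v.1, v.2).
    by rewrite sqr_ge0/=; nra.
  + have := integrableZl measurableT 2 (weight2_integrable k t s).
    exact: eq_integrable.
Qed.

(** The proxy of index [j] reads only weights up to [j] off [t], hence weights below [k] when
    [j < k]. *)
Let M_before k : measurable_fun setT (M k : TX (before k) -> R).
Proof.
apply: measurableT_comp => //; apply: measurable_funB.
  by apply: measurable_funM => //; apply: measurable_funB => //; exact: g_before.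
apply: measurable_funM => //.
rewrite (_ : (fun t => _) = fun t => \sum_(j < n)
    if (j < k)%N then variance_proxy j t t else 0); last first.
  by apply/funext => t; rewrite big_mkcond.
apply: measurable_sum => j; have [jk|_] := ltnP j k; last exact: measurable_cst.
apply: (@measurable_variance_proxy _ (TX (before k)) idfun idfun) => [i ij|].
  by apply: mWJ; exact: ltn_trans ij jk.
exact: mWJ.
Qed.

(** Decoupling moves coordinate [k] to its own point [s]. Then [M k t] leaves the inner integral,
    and the integral of the remaining factor is at most 1. *)
Let step (k : 'I_n) : (\int[P]_t (M k.+1 t)%:E <= \int[P]_t (M k t)%:E)%E.
Proof.
under eq_integral do rewrite MS.
have ind : independent2 P <<s GX (before k) >> <<s GX (at_ k) >>.
  apply: (mutually_independent_blocks mX) => //.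
  by apply/disj_set2P/seteqP; split => // i [/= ik ikE]; move: ik; rewrite /before /mkset ikE ltnn.
have mD : measurable_fun setT
    ((fun w => D k w.1 w.2) : (TX (before k) * TX (at_ k))%type -> R).
  apply: measurableT_comp => //; apply: measurable_funB; apply: measurable_funM => //.
    apply: measurable_funB; first exact: G_before_at.
    exact: (measurableT_comp (@g_before k) measurable_fst).
  apply: (@measurable_variance_proxy _ (TX (before k) * TX (at_ k))%type fst snd) => [i ik|].
    exact: (measurableT_comp (mWJ ik : measurable_fun setT (W i : TX (before k) -> R)) measurable_fst).
  exact: (measurableT_comp (@mWJ (at_ k) k erefl) measurable_snd).
have M0 t : 0 <= M k t by exact: expR_ge0.
have idm J : measurable_fun setT (idfun : T -> TX J).
  by move=> _ B mB; rewrite setTI; exact: sigma_generated_measurable mB.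
have mMT : measurable_fun setT (M k) by exact: (measurableT_comp (@M_before k) (idm _)).
have mDT : measurable_fun setT (fun w : T * T => D k w.1 w.2).
  apply: (measurableT_comp mD (g := idfun : T * T -> TX (before k) * TX (at_ k))).
  apply/measurable_fun_pairP; split.
    exact: (measurableT_comp (idm _) measurable_fst).
  exact: (measurableT_comp (idm _) measurable_snd).
rewrite (@decouple _ _ _ P (GX (before k)) (GX (at_ k)) (@mGX _) (@mGX _) ind
  (fun w => M k w.1 * D k w.1 w.2)); last 2 first.
- apply: measurable_funM; last exact: mD.
  exact: (measurableT_comp (@M_before k) measurable_fst).
- by move=> w; rewrite mulr_ge0 ?expR_ge0.
have mD1 t : measurable_fun setT (fun s => (D k t s)%:E).
  by apply/measurable_EFinP; exact: (measurable_fun_pair2 t mDT).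
have E t : (\int[P]_s (M k t * D k t s)%:E = (M k t)%:E * \int[P]_s (D k t s)%:E)%E.
  under eq_integral do rewrite EFinM.
  by rewrite ge0_integralZl_EFin// => s _; rewrite lee_fin expR_ge0.
under eq_integral do rewrite E.
apply: ge0_le_integral => //.
- by move=> t _; rewrite mule_ge0// ?lee_fin//; apply: integral_ge0 => s _; rewrite lee_fin expR_ge0.
- apply: emeasurable_funM; first exact/measurable_EFinP.
  apply: (measurable_fun_fubini_tonelli_F (fun w => (D k w.1 w.2)%:E)).
    exact/measurable_EFinP.
  by move=> w; rewrite lee_fin expR_ge0.
- exact/measurable_EFinP.
- by move=> t _; rewrite -[leRHS]mule1 lee_wpmul2l// lee_fin.
Qed.

Lemma exp_moment_le1 : (\int[P]_t (expR (l * (f_wa W Rr t - Ef)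
  - l ^+ 2 * \sum_(j < n) variance_proxy j t t))%:E <= 1)%E.
Proof.
have M0 : (\int[P]_t (M 0 t)%:E = 1)%E.
  rewrite -[RHS](integral_probability_cst P); apply: eq_integral => t _.
  rewrite /M big_pred0// mulr0 subr0.
  have -> : g 0 t = Ef by apply: eq_Rintegral => u _; exact: f_wa_ext.
  by rewrite subrr mulr0 expR0.
have Mk k : (k <= n)%N -> (\int[P]_t (M k t)%:E <= 1)%E.
  elim: k => [|k IH] kn; first by rewrite M0.
  exact: le_trans (step (Ordinal kn)) (IH (ltnW kn)).
(* At [n] every coordinate is read off [t], so the integral defining [g n] is that of a constant. *)
have E t : expR (l * (f_wa W Rr t - Ef)
    - l ^+ 2 * \sum_(j < n) variance_proxy j t t) = M n t.
  have gE : g n t = f_wa W Rr t.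
    rewrite -[RHS](Rintegral_probability_cst P); apply: eq_Rintegral => u _.
    by apply: f_wa_ext => j; rewrite split_atn.
  have sE : \sum_(j < n | (j < n)%N) variance_proxy j t t =
      \sum_(j < n) variance_proxy j t t.
    by apply: eq_bigl => j; rewrite ltn_ord.
  by rewrite /M gE sE.
under eq_integral do rewrite E.
exact: Mk.
Qed.

End exponential.
End martingale.

(** * The conditional variance proxy *)

Lemma eq_law_integral d (T : measurableType d) (R : realType)
    (P : probability T R) (X X' : T -> R) (F : R -> \bar R) :
  measurable_fun setT X -> measurable_fun setT X' ->
  (forall A : set R, measurable A -> P (X' @^-1` A) = P (X @^-1` A)) ->
  measurable_fun setT F -> (forall x, 0 <= F x)%E ->
  (\int[P]_t F (X' t) = \int[P]_t F (X t))%E.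
Proof.
move=> mX mX' XX' mF F0.
pose Y : {mfun T >-> R} := HB.pack X (isMeasurableFun.Build _ _ _ _ _ mX).
pose Y' : {mfun T >-> R} := HB.pack X' (isMeasurableFun.Build _ _ _ _ _ mX').
transitivity (\int[distribution P Y']_x F x)%E.
  by rewrite ge0_integral_distribution.
transitivity (\int[distribution P Y]_x F x)%E; last first.
  by rewrite ge0_integral_distribution.
by apply: eq_measure_integral => A mA _; exact: XX'.
Qed.

(** On [A] the difference [g - f] is positive while its integral vanishes. *)
Lemma ge0_ae_le_of_integral d (T : measurableType d) (R : realType)
    (P : probability T R) (f g : T -> R) :
  let A := [set t | f t < g t] in
  measurable_fun setT f -> measurable_fun setT g -> measurable A ->
  P.-integrable setT (EFin \o f) -> P.-integrable setT (EFin \o g) ->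
  (\int[P]_(t in A) (f t)%:E = \int[P]_(t in A) (g t)%:E)%E -> P A = 0%E.
Proof.
move=> A mf mg mA If Ig fg.
have IfA : P.-integrable A (EFin \o f) by exact: integrableS If.
have IgA : P.-integrable A (EFin \o g) by exact: integrableS Ig.
have mgf : measurable_fun A (fun t => (g t - f t)%:E).
  by apply/measurable_EFinP; apply: measurable_funTS; exact: measurable_funB.
have : (\int[P]_(t in A) `|(g t - f t)%:E| = 0)%E.
  rewrite (eq_integral (fun t => (g t)%:E - (f t)%:E)%E); last first.
    move=> t; rewrite inE => /= At.
    by rewrite ger0_norm ?EFinB// subr_ge0 ltW.
  rewrite integralB// fg subee//.
  exact: (integrable_fin_num mA IgA).
move/(ae_eq_integral_abs P mA mgf) => [N [mN PN AN]].
apply/eqP; rewrite eq_le measure_ge0 andbT -PN le_measure ?inE//.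
move=> t At; apply: AN => /= /(_ At) [] /eqP.
by rewrite subr_eq0 gt_eqF.
Qed.

Section conditional_variance.
Context d (T : measurableType d) (R : realType) (P : probability T R) (n : nat).
Context (W Rr W' : 'I_n -> T -> R) (k : 'I_n).
Hypotheses (mW : forall i, measurable_fun setT (W i))
  (mR : forall i, measurable_fun setT (Rr i))
  (mW' : forall i, measurable_fun setT (W' i)).
Hypotheses (W_gt0 : forall i t, 0 < W i t).
Hypothesis indX :
  mutually_independent P (fun i => sigma_of (pair_rv (W i) (Rr i))).
Hypothesis lawW' :
  forall A : set R, measurable A -> P (W' k @^-1` A) = P (W k @^-1` A).
Hypothesis indW' : independent2 P (sigma_of (W' k))
  (sigma_fam setT (fun i => pair_rv (W i) (Rr i))).
Local Notation Q := (P \x P)%E.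
Local Notation GW J := (\bigcup_(i in J) sigma_of (W i)).
Local Notation TW J := (g_sigma_algebraType (GW J)).

Let upto : set 'I_n := [set j : 'I_n | (j <= k)%N].
Let after : set 'I_n := [set j : 'I_n | (k < j)%N].

Let sigma_fam_fst (J : set 'I_n) :
  sigma_fam J W `<=` sigma_fam J (fun i => pair_rv (W i) (Rr i)).
Proof.
apply: smallest_sub; first exact: smallest_sigma_algebra.
move=> A [i Ji [B mB <-]]; apply: sub_gen_smallest; exists i => //.
exists (B `*` setT); first exact: measurableX.
by apply/seteqP; split => t /= [? //]; case.
Qed.

Let mGW J : GW J `<=` measurable.
Proof. by move=> A [i _]; exact: sigma_of_measurable. Qed.

Let mWJ (J : set 'I_n) i : J i -> measurable_fun setT (W i : TW J -> R).
Proof. exact: measurable_sigma_fam. Qed.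

Let ind_upto_after : independent2 P <<s GW upto >> <<s GW after >>.
Proof.
apply: (independent2S (@sigma_fam_fst upto) (@sigma_fam_fst after)).
apply: mutually_independent_blocks => //.
  by move=> i; exact: measurable_fun_pair.
apply/disj_set2P/seteqP; split => // i [].
by rewrite /upto /after /mkset leqNgt => /negbTE ->.
Qed.

(* The share of weight of the [k]-th item after its weight is replaced by [w],
   the other weights being read off [t] before [k] and off [u] after [k]. *)
Let share (w : R) (t u : T) : R :=
  w / (w + \sum_(j < n | j != k) split_at k W j (t, u)).

Let weight_share t s u : weight W k (t, s, u) = share (W k s) t u.
Proof.
rewrite /weight /Wtilde /share (bigD1 k)//= splice_at.
congr (_ / (_ + _)); apply: eq_bigr => j jk.
by rewrite (splice_neq _ _ s u)// splice_split.
Qed.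

Let Wtilde_share t : Wtilde W k t = share (W k t) t t.
Proof.
rewrite /Wtilde /share (bigD1 k)//=; congr (_ / (_ + _)).
by apply: eq_bigr => j _; rewrite /split_at/=; case: ifP.
Qed.

Let Utilde_share t : Utilde W W' k t = share (W' k t) t t.
Proof.
rewrite /Utilde /share; congr (_ / (_ + _)).
by apply: eq_bigr => j _; rewrite /split_at/=; case: ifP.
Qed.

Let measurable_share dZ (Z : measurableType dZ) (w : Z -> R) (a b : Z -> T) :
  measurable_fun setT w ->
  (forall i : 'I_n, (i < k)%N -> measurable_fun setT (W i \o a)) ->
  (forall i : 'I_n, (k < i)%N -> measurable_fun setT (W i \o b)) ->
  measurable_fun setT (fun z => share (w z) (a z) (b z)).
Proof.
move=> mw ma mb; apply: measurable_divr => //; apply: measurable_funD => //.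
rewrite (_ : (fun z => _) = fun z => \sum_(j < n)
    if j != k then split_at k W j (a z, b z) else 0); last first.
  by apply/funext => z; rewrite big_mkcond.
apply: measurable_sum => j; have [_|jk] /= := eqVneq j k.
  exact: measurable_cst.
rewrite /split_at/=; have [jlt|kj] := ltnP j k; first exact: ma.
by apply: mb; rewrite ltn_neqAle eq_sym kj andbT.
Qed.

(** * Integrals over an event of the conditioning sigma-algebra *)

Section event.
Variables (A : set T) (sA : sigma_fam upto W A).

Let mA : measurable A.
Proof. exact: (sigma_fam_measurable mW sA). Qed.

Let mindA : measurable_fun setT (\1_A : TW upto -> R).
Proof. by apply: measurable_indic; exact: sA. Qed.

Let mI : measurable_fun setT (\1_A : T -> R).
Proof. exact: measurable_indic. Qed.

Let f_ge0 w t u : 0 <= \1_A t * share w t u ^+ 2.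
Proof. by rewrite mulr_ge0 ?sqr_ge0. Qed.

(** [A] and the weights up to [k] stay at [t]; only the later weights move to a fresh point. *)
Let integral_Wtilde :
  (\int[P]_t (\1_A t * Wtilde W k t ^+ 2)%:E =
   \int[P]_t \int[P]_u (\1_A t * weight W k (t, t, u) ^+ 2)%:E)%E.
Proof.
under eq_integral do rewrite Wtilde_share.
rewrite (@decouple _ _ _ P (GW upto) (GW after) (@mGW _) (@mGW _) ind_upto_after
  (fun w => \1_A w.1 * share (W k w.1) w.1 w.2 ^+ 2)).
- apply: eq_integral => t _; apply: eq_integral => u _.
  by rewrite weight_share.
- apply: measurable_funM.
    exact: (measurableT_comp mindA measurable_fst).
  apply: measurable_funX.
  apply: (@measurable_share _ (TW upto * TW after)%type (fun w => W k w.1) fst snd).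
  + exact: (measurableT_comp (@mWJ upto k (leqnn k)) measurable_fst).
  + move=> i ik; apply: (measurableT_comp _ measurable_fst).
    exact: (@mWJ upto i (ltnW ik)).
  + move=> i ki; exact: (measurableT_comp (@mWJ after i ki) measurable_snd).
- by move=> w; exact: f_ge0.
Qed.

(** [W' k] is decoupled from all weights and replaced, by equality of laws, with [W k] at a fresh
    point [s]; for fixed [s], the weights after [k] are then decoupled from the earlier ones. [A]
    may involve [W k], which therefore stays at [t] in the indicator while the share reads it at
    [s]. *)
Let integral_Utilde :
  (\int[P]_t (\1_A t * Utilde W W' k t ^+ 2)%:E =
   \int[P]_t \int[P]_s \int[P]_u (\1_A t * weight W k (t, s, u) ^+ 2)%:E)%E.
Proof.
under eq_integral do rewrite Utilde_share.
have mW1 : sigma_of (W' k) `<=` measurable by exact: sigma_of_measurable.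
have ind1 : independent2 P <<s sigma_of (W' k) >> <<s GW setT >>.
  apply: independent2_generatedl => //.
  - exact: sigma_generated_measurable.
  - exact: sigma_of_setI.
  - by apply: (independent2S _ _ indW') => //; exact: sigma_fam_fst.
rewrite (@decouple _ _ _ P (sigma_of (W' k)) (GW setT) mW1 (@mGW _) ind1
  (fun w => \1_A w.2 * share (W' k w.1) w.2 w.2 ^+ 2)); last 2 first.
- apply: measurable_funM.
    apply: (measurableT_comp (f := \1_A : TW setT -> R) _ measurable_snd).
    apply: measurable_indic.
    have sub : sigma_fam upto W `<=` sigma_fam setT W.
      apply: smallest_sub; first exact: smallest_sigma_algebra.
      by move=> B [i _ sB]; apply: sub_gen_smallest; exists i.
    exact: (sub _ sA).
  apply: measurable_funX.
  apply: (@measurable_share _ (g_sigma_algebraType (sigma_of (W' k)) * TW setT)%type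
    (fun w => W' k w.1) snd snd).
  + apply: (measurableT_comp (f := (W' k : g_sigma_algebraType (sigma_of (W' k)) -> R)) _ measurable_fst).
    by move=> _ B mB; apply: sub_gen_smallest; exists B.
  + by move=> i _; exact: (measurableT_comp (@mWJ setT i I) measurable_snd).
  + by move=> i _; exact: (measurableT_comp (@mWJ setT i I) measurable_snd).
- by move=> w; exact: f_ge0.
rewrite /=.
have mF : measurable_fun setT
    (fun z : R * T => (\1_A z.2 * share z.1 z.2 z.2 ^+ 2)%:E).
  apply/measurable_EFinP; apply: measurable_funM.
    exact: (measurableT_comp mI measurable_snd).
  apply: measurable_funX; apply: (@measurable_share _ (R * T)%type fst snd snd).
  + exact: measurable_fst.
  + by move=> i _; exact: (measurableT_comp (mW i) measurable_snd).
  + by move=> i _; exact: (measurableT_comp (mW i) measurable_snd).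
pose Phi w := (\int[P]_t (\1_A t * share w t t ^+ 2)%:E)%E.
have mPhi : measurable_fun setT Phi.
  apply: (measurable_fun_fubini_tonelli_F
    (fun z : R * T => (\1_A z.2 * share z.1 z.2 z.2 ^+ 2)%:E)) => // z.
  by rewrite lee_fin f_ge0.
have Phi0 w : (0 <= Phi w)%E.
  by apply: integral_ge0 => t _; rewrite lee_fin f_ge0.
transitivity (\int[P]_s Phi (W k s))%E.
  exact: (eq_law_integral (mW k) (mW' k) lawW' mPhi Phi0).
pose F (z : T * T) := (\int[P]_u (\1_A z.1 * weight W k (z.1, z.2, u) ^+ 2)%:E)%E.
have mF3 : measurable_fun setT (fun z : T * T * T =>
    (\1_A z.1.1 * weight W k (z.1.1, z.1.2, z.2) ^+ 2)%:E).
  apply/measurable_EFinP; apply: measurable_funM.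
    apply: (measurableT_comp mI).
    exact: (measurableT_comp measurable_fst measurable_fst).
  apply: measurable_funX.
  apply: (@measurable_weight _ _ _ _ _ _ (T * T * T)%type
    (fun z => z.1.1) (fun z => z.1.2) snd).
  + move=> i _; apply: (measurableT_comp (mW i)).
    exact: (measurableT_comp measurable_fst measurable_fst).
  + apply: (measurableT_comp (mW k)).
    exact: (measurableT_comp measurable_snd measurable_fst).
  + by move=> i _; exact: (measurableT_comp (mW i) measurable_snd).
have mFF : measurable_fun setT F.
  apply: (measurable_fun_fubini_tonelli_F (fun z : T * T * T =>
    (\1_A z.1.1 * weight W k (z.1.1, z.1.2, z.2) ^+ 2)%:E)) => // z.
  by rewrite lee_fin mulr_ge0 ?sqr_ge0.
have F0 z : (0 <= F z)%E.
  by apply: integral_ge0 => u _; rewrite lee_fin mulr_ge0 ?sqr_ge0.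
transitivity (\int[P]_s \int[P]_t F (t, s))%E; last first.
  exact: (esym (fubini_tonelli F mFF F0)).
rewrite /Phi /F /=.
apply: eq_integral => s _.
rewrite (@decouple _ _ _ P (GW upto) (GW after) (@mGW _) (@mGW _) ind_upto_after
  (fun w => \1_A w.1 * share (W k s) w.1 w.2 ^+ 2)).
- apply: eq_integral => t _; apply: eq_integral => u _.
  by rewrite weight_share.
- apply: measurable_funM.
    exact: (measurableT_comp mindA measurable_fst).
  apply: measurable_funX.
  apply: (@measurable_share _ (TW upto * TW after)%type (fun=> W k s) fst snd).
  + exact: measurable_cst.
  + move=> i ik; apply: (measurableT_comp _ measurable_fst).
    exact: (@mWJ upto i (ltnW ik)).
  + move=> i ki; exact: (measurableT_comp (@mWJ after i ki) measurable_snd).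
- by move=> w; exact: f_ge0.
Qed.

(** Holding for every conditioning event, this identity makes the diagonal proxy a version of the
    conditional expectation. *)
Lemma integral_variance_proxy :
  (\int[P]_(t in A) (Wtilde W k t ^+ 2 + Utilde W W' k t ^+ 2)%:E =
   \int[P]_(t in A) (variance_proxy P W k t t)%:E)%E.
Proof.
have mWt : measurable_fun setT (Wtilde W k) by exact: measurable_Wtilde.
have mUt : measurable_fun setT (Utilde W W' k).
  rewrite (_ : Utilde W W' k = fun t => share (W' k t) t t); last first.
    by apply/funext => t; exact: Utilde_share.
  apply: (@measurable_share _ T (W' k) idfun idfun); first exact: mW'.
    by move=> i _; exact: mW.
  by move=> i _; exact: mW.
have indE (f : T -> R) :
    (\int[P]_(t in A) (f t)%:E = \int[P]_t (\1_A t * f t)%:E)%E.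
  rewrite integral_mkcond epatch_indic; apply: eq_integral => t _ /=.
  by rewrite -EFinM mulrC.
rewrite !indE.
transitivity (\int[P]_t ((\1_A t * Wtilde W k t ^+ 2)%:E +
    (\1_A t * Utilde W W' k t ^+ 2)%:E))%E.
  by apply: eq_integral => t _; rewrite -EFinD mulrDr.
rewrite ge0_integralD//; last 4 first.
- by move=> t _; rewrite lee_fin mulr_ge0 ?sqr_ge0.
- by apply/measurable_EFinP; apply: measurable_funM => //; exact: measurable_funX.
- by move=> t _; rewrite lee_fin mulr_ge0 ?sqr_ge0.
- by apply/measurable_EFinP; apply: measurable_funM => //; exact: measurable_funX.
pose w2 t s u := weight W k (t, s, u) ^+ 2.
have w20 t s u : 0 <= w2 t s u by exact: sqr_ge0.
have mw2 : measurable_fun setT (fun z : T * T * T => w2 z.1.1 z.1.2 z.2).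
  apply: measurable_funX.
  apply: (@measurable_weight _ _ _ _ _ _ (T * T * T)%type
    (fun z => z.1.1) (fun z => z.1.2) snd).
  - move=> i _; apply: (measurableT_comp (mW i)).
    exact: (measurableT_comp measurable_fst measurable_fst).
  - apply: (measurableT_comp (mW k)).
    exact: (measurableT_comp measurable_snd measurable_fst).
  - by move=> i _; exact: (measurableT_comp (mW i) measurable_snd).
have mw2d : measurable_fun setT (fun z : T * T => w2 z.1 z.1 z.2).
  apply: (measurableT_comp mw2 (g := fun z : T * T => (z.1, z.1, z.2))).
  apply: measurable_fun_pair; last exact: measurable_snd.
  by apply: measurable_fun_pair; exact: measurable_fst.
have mI1 : measurable_fun setT (fun t => \int[P]_u (\1_A t * w2 t t u)%:E)%E.
  apply: (measurable_fun_fubini_tonelli_F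
    (fun z : T * T => (\1_A z.1 * w2 z.1 z.1 z.2)%:E)).
    apply/measurable_EFinP; apply: measurable_funM => //.
    exact: (measurableT_comp mI measurable_fst).
  by move=> z; rewrite lee_fin mulr_ge0.
have mI2 : measurable_fun setT
    (fun t => \int[P]_s \int[P]_u (\1_A t * w2 t s u)%:E)%E.
  apply: (measurable_fun_fubini_tonelli_F
    (fun z : T * T => \int[P]_u (\1_A z.1 * w2 z.1 z.2 u)%:E)%E).
    apply: (measurable_fun_fubini_tonelli_F
      (fun z : T * T * T => (\1_A z.1.1 * w2 z.1.1 z.1.2 z.2)%:E)).
      apply/measurable_EFinP; apply: measurable_funM => //.
      apply: (measurableT_comp mI).
      exact: (measurableT_comp measurable_fst measurable_fst).
    by move=> z; rewrite lee_fin mulr_ge0.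
  by move=> z; apply: integral_ge0 => u _; rewrite lee_fin mulr_ge0.
rewrite integral_Wtilde integral_Utilde.
pose I1 t := (\int[P]_u (\1_A t * w2 t t u)%:E)%E.
pose I2 t := (\int[P]_s \int[P]_u (\1_A t * w2 t s u)%:E)%E.
have I10 t : setT t -> (0 <= I1 t)%E.
  by move=> _; apply: integral_ge0 => u _; rewrite lee_fin mulr_ge0.
have I20 t : setT t -> (0 <= I2 t)%E.
  move=> _; apply: integral_ge0 => s _; apply: integral_ge0 => u _.
  by rewrite lee_fin mulr_ge0.
transitivity (\int[P]_t (I1 t + I2 t))%E.
  exact: (esym (ge0_integralD P measurableT I10 mI1 I20 mI2)).
rewrite /I1 /I2.
apply: eq_integral => t _.
have : \1_A t = 1 :> R \/ \1_A t = 0 :> R.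
  by rewrite indicE; case: (t \in A); [left|right].
case=> ->; last first.
  rewrite mul0r integral0_eq => [|u _]; last by rewrite mul0r.
  rewrite integral0_eq ?adde0// => s _.
  by rewrite integral0_eq// => u _; rewrite mul0r.
rewrite mul1r /variance_proxy EFin_Rintegral; last exact: weight2_integrable.
transitivity (\int[P]_u (w2 t t u)%:E + \int[P]_s \int[P]_u (w2 t s u)%:E)%E.
  congr (_ + _)%E; first by apply: eq_integral => u _; rewrite mul1r.
  by apply: eq_integral => s _; apply: eq_integral => u _; rewrite mul1r.
have mv1 : measurable_fun setT (fun v : T * T => w2 t t v.2).
  apply: (measurableT_comp mw2 (g := fun v : T * T => (t, t, v.2))).
  by apply: measurable_fun_pair => //; exact: measurable_snd.
have mv2 : measurable_fun setT (fun v : T * T => w2 t v.1 v.2).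
  apply: (measurableT_comp mw2 (g := fun v : T * T => (t, v.1, v.2))).
  apply: measurable_fun_pair; last exact: measurable_snd.
  by apply: measurable_fun_pair => //; exact: measurable_fst.
transitivity (\int[Q]_v ((w2 t t v.2)%:E + (w2 t v.1 v.2)%:E))%E; last first.
  by apply: eq_integral => v _; rewrite -EFinD.
have ev1 : measurable_fun setT (fun v : T * T => (w2 t t v.2)%:E).
  exact/measurable_EFinP.
have ev2 : measurable_fun setT (fun v : T * T => (w2 t v.1 v.2)%:E).
  exact/measurable_EFinP.
have v10 (v : T * T) : (0 <= (w2 t t v.2)%:E)%E by rewrite lee_fin.
have v20 (v : T * T) : (0 <= (w2 t v.1 v.2)%:E)%E by rewrite lee_fin.
transitivity (\int[Q]_v (w2 t t v.2)%:E + \int[Q]_v (w2 t v.1 v.2)%:E)%E; last first.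
  exact: (esym (ge0_integralD Q measurableT (fun v _ => v10 v) ev1 (fun v _ => v20 v) ev2)).
congr (_ + _)%E; last exact: (esym (fubini_tonelli1 _ ev2 v20)).
(* The first term ignores the copy, so a dummy integral is inserted to match the product measure. *)
transitivity (\int[P]_s \int[P]_u (w2 t t u)%:E)%E.
  by rewrite integral_probability_cst.
exact: (esym (fubini_tonelli1 _ ev1 v10)).
Qed.

End event.

(** The set where [Y] falls below the proxy lies in the conditioning sigma-algebra, so both have the
    same integral over it, which forces it to be null. *)
Lemma cond_exp_ge_variance_proxy (Y : T -> R) :
  is_cond_exp P (sigma_fam upto W)
    (fun t => Wtilde W k t ^+ 2 + Utilde W W' k t ^+ 2) Y ->
  measurable_fun setT Y /\
  exists N, [/\ measurable N, P N = 0%E &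
    forall t, ~ N t -> variance_proxy P W k t t <= Y t].
Proof.
move=> [mY IY EY].
have mYG : measurable_fun setT (Y : TW upto -> R).
  by move=> _ B mB; rewrite setTI; exact: mY.
have mvG : measurable_fun setT ((fun t => variance_proxy P W k t t) : TW upto -> R).
  apply: (@measurable_variance_proxy _ _ _ P _ W mW W_gt0 _ (TW upto) idfun idfun) => [i ik|].
    exact: (@mWJ upto i (ltnW ik)).
  exact: (@mWJ upto k (leqnn k)).
have mYT : measurable_fun setT Y.
  by move=> _ B mB; apply: (sigma_fam_measurable mW); exact: mYG.
have mvT : measurable_fun setT (fun t => variance_proxy P W k t t).
  apply: (@measurable_variance_proxy _ _ _ P _ W mW W_gt0 _ T idfun idfun).
    by move=> i _; exact: mW.
  exact: mW.
split => //.
have sN : sigma_fam upto W [set t | Y t < variance_proxy P W k t t].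
  exact: (measurable_pred (measurable_fun_ltr mYG mvG)).
exists [set t | Y t < variance_proxy P W k t t]; split.
- exact: (sigma_fam_measurable mW sN).
- apply: ge0_ae_le_of_integral => //.
  + exact: (sigma_fam_measurable mW sN).
  + apply: (@itv_integrable _ _ _ _ _ 2) => // t.
    exact: variance_proxy_02.
  + by rewrite EY// integral_variance_proxy.
- by move=> t /= /negP; rewrite -leNgt.
Qed.

End conditional_variance.

(** * Gaussian mixture *)

Lemma measurable_sqrtr (R : realType) : measurable_fun setT (@Num.sqrt R).
Proof. by apply: nondecreasing_measurable => // a b; exact: ler_wsqrtr. Qed.

Section gaussian_mixture.
Context d (T : measurableType d) (R : realType) (P : probability T R).

(** Inverse variances add when the square is completed, so the density is expressed through [a], the
    inverse variance. *)
Lemma normal_pdf_precision (a m l : R) : 0 < a ->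
  normal_pdf m (Num.sqrt a)^-1 l =
  Num.sqrt (a / (pi * 2)) * expR (- ((l - m) ^+ 2 * a / 2)).
Proof.
move=> a0; have sa0 : 0 < Num.sqrt a by rewrite sqrtr_gt0.
rewrite normal_pdfE; last by rewrite gt_eqF// invr_gt0.
rewrite /normal_peak /normal_fun exprVn sqr_sqrtr ?(ltW a0)//.
have pi0 := pi_gt0 R.
congr (_ * expR _); last by field; rewrite gt_eqF.
rewrite -sqrtrV; last by rewrite mulrn_wge0// mulr_ge0 ?invr_ge0 ?ltW.
by rewrite -mulr_natr !invfM invrK mulrA.
Qed.

(** Closed form of the integral of exp (l x - l^2 v / 2) over a centred Gaussian [l] of variance 1 /
    y; the square root is the ratio of normalising constants. *)
Definition mixture (y x v : R) : R :=
  Num.sqrt (y / (v + y)) * expR (x ^+ 2 / (2 * (v + y))).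

(* Completing the square: a Gaussian mixture over [l] of [exp (l x - l^2 v / 2)]
   is a Gaussian density in [l] up to a factor. *)
Lemma normal_mixture (x v y l : R) : 0 <= v -> 0 < y ->
  normal_pdf 0 (Num.sqrt y)^-1 l * expR (l * x - l ^+ 2 / 2 * v) =
  mixture y x v * normal_pdf (x / (v + y)) (Num.sqrt (v + y))^-1 l.
Proof.
move=> v0 y0; have k0 : 0 < v + y by lra.
have pi0 := pi_gt0 R.
rewrite /mixture !normal_pdf_precision// [RHS]mulrACA -sqrtrM; last first.
  by rewrite divr_ge0// ltW.
rewrite -[RHS]/(_ * (_ * _)) -expRD -[LHS]mulrA -expRD.
congr (Num.sqrt _ * expR _); last by field; rewrite gt_eqF.
by move: (pi : R) pi0 => q q0; field; rewrite !gt_eqF.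
Qed.

Context (X V : T -> R) (y : R).
Hypotheses (mX : measurable_fun setT X) (mV : measurable_fun setT V).
Hypotheses (V0 : forall t, 0 <= V t) (y0 : 0 < y).
Hypothesis expXV :
  forall l, (\int[P]_t (expR (l * X t - l ^+ 2 / 2 * V t))%:E <= 1)%E.

Lemma measurable_mixture : measurable_fun setT (fun t => mixture y (X t) (V t)).
Proof.
have mk : measurable_fun setT (fun t => V t + y) by exact: measurable_funD.
apply: measurable_funM.
  by apply: (measurableT_comp (@measurable_sqrtr R)); exact: measurable_divr.
apply: (measurableT_comp (@measurable_expR R)); apply: measurable_divr.
  exact: measurable_funX.
exact: measurable_funM.
Qed.

Let C0 t : 0 <= mixture y (X t) (V t).
Proof. by rewrite mulr_ge0 ?sqrtr_ge0 ?expR_ge0. Qed.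

(** Tonelli: integrating over [l] first yields the mixture, integrating over the sample first leaves
    at most the Gaussian density [p], of mass 1. *)
Lemma integral_mixture_le1 : (\int[P]_t (mixture y (X t) (V t))%:E <= 1)%E.
Proof.
pose p l := normal_pdf 0 (Num.sqrt y)^-1 l.
pose E (z : T * R) := expR (z.2 * X z.1 - z.2 ^+ 2 / 2 * V z.1).
pose F (z : T * R) := (p z.2 * E z)%:E.
have mE : measurable_fun setT E.
  apply: (measurableT_comp (@measurable_expR R)); apply: measurable_funB.
    apply: measurable_funM; first exact: measurable_snd.
    exact: (measurableT_comp mX measurable_fst).
  apply: measurable_funM; last exact: (measurableT_comp mV measurable_fst).
  apply: measurable_funM; last exact: measurable_cst.
  exact: (measurable_funX 2 measurable_snd).
have mp : measurable_fun setT p by exact: measurable_normal_pdf.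
have mF : measurable_fun setT F.
  apply/measurable_EFinP; apply: measurable_funM => //.
  exact: (measurableT_comp mp measurable_snd).
have p0 l : 0 <= p l by exact: normal_pdf_ge0.
have F0 z : (0 <= F z)%E by rewrite lee_fin mulr_ge0 ?expR_ge0.
have EC t : ((mixture y (X t) (V t))%:E = \int[lebesgue_measure]_l F (t, l))%E.
  transitivity (\int[lebesgue_measure]_l ((mixture y (X t) (V t))%:E *
      (normal_pdf (X t / (V t + y)) (Num.sqrt (V t + y))^-1 l)%:E))%E; last first.
    by apply: eq_integral => l _; rewrite /F /E /p -EFinM /= normal_mixture.
  rewrite ge0_integralZl_EFin//; last 2 first.
  - by move=> l _; rewrite lee_fin normal_pdf_ge0.
  - by apply/measurable_EFinP; exact: measurable_normal_pdf.
  by rewrite integral_normal_pdf mule1.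
have -> : (\int[P]_t (mixture y (X t) (V t))%:E =
    \int[lebesgue_measure]_l \int[P]_t F (t, l))%E.
  under eq_integral do rewrite EC.
  have H := @fubini_tonelli _ _ T _ R P lebesgue_measure F mF F0.
  exact: H.
have mE1 l : measurable_fun setT (fun t => (E (t, l))%:E).
  by apply/measurable_EFinP; exact: measurable_fun_pair1.
apply: (@le_trans _ _ (\int[lebesgue_measure]_l (p l)%:E)%E); last first.
  by rewrite /p integral_normal_pdf.
apply: ge0_le_integral => //.
- by move=> l _; exact: integral_ge0.
- exact: (measurable_fun_fubini_tonelli_G F).
- exact/measurable_EFinP.
- move=> l _.
  have -> : (\int[P]_t F (t, l) = (p l)%:E * \int[P]_t (E (t, l))%:E)%E.
    have E0 t : setT t -> (0 <= (E (t, l))%:E)%E by rewrite lee_fin expR_ge0.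
    transitivity (\int[P]_t ((p l)%:E * (E (t, l))%:E))%E.
      by apply: eq_integral => t _; rewrite -EFinM.
    exact: (ge0_integralZl_EFin P measurableT E0 (mE1 l) (p0 l)).
  by rewrite -[leRHS]mule1 lee_wpmul2l ?lee_fin//; exact: expXV.
Qed.

Lemma mixture_tail (x : R) : 
  (P [set t | (expR x < mixture y (X t) (V t))%R] <= (expR (- x))%:E)%E.
Proof.
set A := [set t | _].
have mA : measurable A.
  exact: (measurable_pred (measurable_fun_ltr (measurable_cst (expR x)) measurable_mixture)).
have : ((expR x)%:E * P A <= 1)%E.
  apply: le_trans integral_mixture_le1.
  have -> : P A = (\int[P]_t (\1_A t)%:E)%E by rewrite integral_indic// setIT.
  have mI : measurable_fun setT (fun t => (\1_A t : R)%:E).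
    by apply/measurable_EFinP; exact: measurable_indic.
  have I0 t : setT t -> (0 <= (\1_A t : R)%:E)%E by rewrite lee_fin.
  rewrite -(ge0_integralZl_EFin P measurableT I0 mI (expR_ge0 x)).
  apply: ge0_le_integral; [exact: measurableT| | | |].
  - by move=> t _; rewrite -EFinM lee_fin mulr_ge0 ?expR_ge0.
  - by apply/measurable_EFinP; apply: measurable_funM => //; exact/measurable_EFinP.
  - exact/measurable_EFinP/measurable_mixture.
  - move=> t _; rewrite -EFinM lee_fin indicE.
    case: (boolP (t \in A)) => [|_]; last by rewrite mulr0.
    by rewrite inE => /ltW; rewrite mulr1.
have [p ->] : exists p, P A = p%:E.
  by exists (fine (P A)); rewrite fineK// fin_num_measure.
rewrite -EFinM !lee_fin expRN => px.
by rewrite -(ler_pM2l (expR_gt0 x)) divff// gt_eqF ?expR_gt0.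
Qed.

End gaussian_mixture.

(** The prefactor is the inverse of sqrt (1 + v / y), so logarithms give X^2 <= 2 (v + y) (x + L v).
    The right side increases with [v], which lets [w] replace it, and [1 <= x] gives x + L v <= (1 +
    L w) x. *)
Lemma mixture_bound (R : realType) (X v w y x : R) : 0 <= v -> v <= w ->
  0 < y -> 1 <= x ->
  mixture y X v <= expR x ->
  `|X| <= Num.sqrt (2 * (w + y) * (1 + ln (Num.sqrt (1 + w / y))) * x).
Proof.
move=> v0 vw y0 x1 hX.
have k0 : 0 < v + y by lra.
pose L (u : R) := ln (Num.sqrt (1 + u / y)).
have u1 u : 0 <= u -> 1 <= 1 + u / y.
  by move=> u0; rewrite lerDl divr_ge0// ltW.
have L0 u : 0 <= u -> 0 <= L u.
  move=> u0; apply: ln_ge0; rewrite -[leLHS]sqrtr1; apply: ler_wsqrtr; exact: u1.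
have Lvw : L v <= L w.
  rewrite /L ler_ln ?posrE ?sqrtr_gt0; last 2 first.
  - by have := u1 _ v0; lra.
  - by have := u1 _ (le_trans v0 vw); lra.
  by apply: ler_wsqrtr; rewrite lerD2l ler_pM2r ?invr_gt0.
have hX2 : X ^+ 2 / (2 * (v + y)) <= x + L v.
  rewrite -ler_expR expRD /L lnK; last by rewrite posrE sqrtr_gt0; have := u1 _ v0; lra.
  have s0 : 0 < Num.sqrt (y / (v + y)) by rewrite sqrtr_gt0 divr_gt0.
  rewrite -(ler_pM2l s0); apply: le_trans hX _.
  rewrite mulrCA -sqrtrM; last by rewrite divr_ge0// ltW.
  have -> : y / (v + y) * (1 + v / y) = 1 by field; rewrite !gt_eqF.
  by rewrite sqrtr1 mulr1.
rewrite -sqrtr_sqr; apply: ler_wsqrtr.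
move: hX2; rewrite ler_pdivrMr; last by rewrite mulr_gt0.
move/le_trans; apply.
have Lw0 := L0 _ (le_trans v0 vw); rewrite -/(L w).
have h1 : x + L v <= (1 + L w) * x by nra.
have h2 : 0 <= x + L v by have := L0 _ v0; lra.
rewrite mulrC -[leRHS]mulrA ler_pM//; first by lra.
by lra.
Qed.

(** * The deviation bound for arbitrary versions of the conditional expectations *)

Unset Implicit Arguments.
Set Strict Implicit.

Theorem theorem6 (d : measure_display) (T : measurableType d) (R : realType)
  (P : probability T R) (n : nat) (W Rr W' Y : 'I_n -> T -> R) :
  (2 <= n)%N ->
  (forall i, measurable_fun setT (W i)) ->
  (forall i, measurable_fun setT (Rr i)) ->
  (forall i, measurable_fun setT (W' i)) ->
  (forall i t, 0 < W i t) ->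
  (forall i t, 0 <= Rr i t <= 1) ->
  (* X_1, ..., X_n mutually independent *)
  mutually_independent P (fun i => sigma_of (pair_rv (W i) (Rr i))) ->
  (* W'_k has the law of W_k *)
  (forall k (A : set R), measurable A -> P (W' k @^-1` A) = P (W k @^-1` A)) ->
  (* W'_k independent of (X_1, ..., X_n) *)
  (forall k, independent2 P (sigma_of (W' k))
                (sigma_fam setT (fun i => pair_rv (W i) (Rr i)))) ->
  (* Y k is (a version of) E[Wtilde_k^2 + Utilde_k^2 | W_1, ..., W_k] *)
  (forall k : 'I_n, is_cond_exp P (sigma_fam [set j : 'I_n | (j <= k)%N] W)
               (fun t => Wtilde W k t ^+ 2 + Utilde W W' k t ^+ 2) (Y k)) ->
  forall y x : R, 0 < y -> 2 <= x ->
  ((1 - expR (- x))%:E <=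
    P [set t | (`| f_wa W Rr t - fine ('E_P[f_wa W Rr]%E) |
                 <= Num.sqrt (2 * (2 * (\sum_(k < n) Y k t) + y)
                     * (1 + ln (Num.sqrt (1 + 2 * (\sum_(k < n) Y k t) / y)))
                     * x))%R])%E.
Proof.
move=> _ mW mR mW' W0 R01 indX lawW' indW' condY y x y0 x2.
pose H t := \sum_(k < n) variance_proxy P W k t t.
have mvp k : measurable_fun setT (fun t => variance_proxy P W k t t).
  apply: (@measurable_variance_proxy _ _ _ P _ W mW W0 _ T idfun idfun).
    by move=> i _; exact: mW.
  exact: mW.
have mH : measurable_fun setT H by exact: measurable_sum.
have H0 t : 0 <= H t.
  by apply: sumr_ge0 => k _; have /andP[] := variance_proxy_02 P mW W0 k t t.
have [mY /choice[N NP]] : (forall k, measurable_fun setT (Y k)) /\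
    (forall k, exists N, [/\ measurable N, P N = 0%E &
      forall t, ~ N t -> variance_proxy P W k t t <= Y k t]).
  by split => k; have [] := cond_exp_ge_variance_proxy mW mR mW' W0 indX
    (lawW' k) (indW' k) (condY k).
have mf : measurable_fun setT (f_wa W Rr) by exact: measurable_f_wa.
set Ef := fine _.
have EfE : Ef = \int[P]_t f_wa W Rr t by rewrite /Ef unlock.
pose X t := f_wa W Rr t - Ef.
have mX : measurable_fun setT X by exact: measurable_funB.
have m2H : measurable_fun setT (fun t => 2 * H t) by exact: measurable_funM.
have H20 t : 0 <= 2 * H t by rewrite mulr_ge0.
(* Here l^2 H is read as l^2 / 2 times 2 H, whence 2 V in the bound. *)
have expXH l : (\int[P]_t (expR (l * X t - l ^+ 2 / 2 * (2 * H t)))%:E <= 1)%E.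
  apply: le_trans (exp_moment_le1 mW mR W0 R01 indX l).
  rewrite le_eqVlt; apply/orP; left; apply/eqP; apply: eq_integral => t _.
  by rewrite /X EfE -/(H t); congr (expR (_ - _))%:E; field.
have tail := mixture_tail mX m2H H20 y0 expXH x.
set B := [set t | (expR x < mixture y (X t) (2 * H t))%R] in tail.
have mB : measurable B.
  exact: (measurable_pred (measurable_fun_ltr (measurable_cst (expR x))
    (measurable_mixture y mX m2H))).
(* The exceptional null sets of the [n] versions; outside them [H] is at most the sum of the
   [Y k]. *)
pose NN := \big[setU/set0]_(k < n) N k.
have mNN : measurable NN.
  by apply: bigsetU_measurable => k _; have [] := NP k.
have PNN : P NN = 0%E.
  apply: (measure_negligible mNN).
  rewrite /NN; apply: (big_ind (fun A => P.-negligible A)).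
  - exact: negligible_set0.
  - by move=> A1 A2; exact: negligibleU.
  - by move=> k _; have [mN PN _] := NP k; exact/negligibleP.
set E := [set t | _].
have mE : measurable E.
  have mS : measurable_fun setT (fun t => \sum_(k < n) Y k t).
    exact: measurable_sum.
  apply: (measurable_pred (measurable_fun_ler _ _)).
    by apply: measurableT_comp => //; exact: measurable_funB.
  apply: (measurableT_comp (@measurable_sqrtr R)).
  apply: measurable_funM => //; apply: measurable_funM.
    apply: measurable_funM => //; apply: measurable_funD => //.
    exact: measurable_funM.
  apply: measurable_funD => //; apply: (measurableT_comp (@measurable_ln R)).
  apply: (measurableT_comp (@measurable_sqrtr R)).
  apply: measurable_funD => //; apply: measurable_divr => //.
  exact: measurable_funM.
have BNE : ~` (B `|` NN) `<=` E.
  move=> t /not_orP[Bt NNt].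
  have HY : 2 * H t <= 2 * \sum_(k < n) Y k t.
    rewrite ler_pM2l//; apply: ler_sum => k _; have [_ _] := NP k; apply.
    by move=> Nt; apply: NNt; rewrite /NN (bigD1 k)//=; left.
  apply: (mixture_bound (H20 t) HY y0); first by lra.
  by move/negP : Bt; rewrite -leNgt.
have mBN : measurable (B `|` NN) by exact: measurableU.
have PBN : (P (B `|` NN) <= (expR (- x))%:E)%E.
  apply: le_trans (measureU2 P mB mNN) _.
  have PNN0 : (P NN <= 0)%E by rewrite PNN.
  by rewrite -[leRHS]adde0; exact: leeD tail PNN0.
have PC : (P (~` (B `|` NN)) <= P E)%E.
  by apply: le_measure => //; rewrite inE//; exact: measurableC.
apply: le_trans PC; rewrite probability_setC// EFinB.
exact: leeB.
Qed.
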